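(* For every integer $d\ge 1$, the pellytope $\mathcal P_d$ determines a binary geometry $\widetilde{\mathcal U}_d\subset\mathbb C^{3d-1}$ defined by $3d-1$ $u$-equations. That is: the Pellspace $\widetilde{\mathcal U}_d\subset\mathbb C^{3d-1}$ is a binary geometry for the flag simplicial complex $\Delta(\Sigma_d)$ on $[3d-1]$, where $\Sigma_d$ is the inner normal fan of $\mathcal P_d$.
   Context: Notation: $[n]=\{1,\dots,n\}$; $e_1,\dots,e_d$ is the standard basis of $\mathbb R^d$; $\mathrm{Newt}(f)$ is the Newton polytope of $f$. Flag complexes. A simplicial complex $\Delta$ on $[n]$ is a non-empty collection of subsets of $[n]$ closed under taking subsets. It is a flag complex if moreover $\{k\}\in\Delta$ for each $k\in[n]$ and $\{k_1,\dots,k_r\}\in\Delta$ whenever $\{k_i,k_j\}\in\Delta$ for all $1\le i<j\le r$. Write $i\nsim j$ ($i,j$ incompatible) if $\{i,j\}\notin\Delta$. Binary geometry. Let $\Delta$ be a flag complex on $[n]$. A $u$-equation for $i\in[n]$ is an equation $R_i=u_i+\prod_{j\nsim i}u_j^{a_{ij}}-1=0$ with integers $a_{ij}>0$. A binary geometry for $\Delta$ is an affine algebraic variety $\widetilde U\subset\mathbb C^n$ cut out by $n$ such equations $R_1=\dots=R_n=0$ such that: (i) $\dim\widetilde U=\max_{S\in\Delta}\#S$; (ii) for $S\subset[n]$ the subvariety $\widetilde U_S=\widetilde U\cap\{u\in\mathbb C^n\mid u_i=0\ \forall i\in S\}$ is non-empty if and only if $S\in\Delta$; (iii) if $\widetilde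 U_S$ is non-empty, it is irreducible of codimension $\#S$ in $\widetilde U$. Pellytope. $\mathcal P_d=\mathrm{Newt}\big(\prod_{i=1}^d(1+y_i)\prod_{j=1}^{d-1}(1+y_j+y_jy_{j+1})\big)\subset\mathbb R^d$. Its inner normal fan $\Sigma_d$ is a simplicial fan with $3d-1$ rays, generated by the entries of the ordered tuple $V=(e_1,\dots,e_d,-e_1,\dots,-e_d,e_1-e_2,\dots,e_{d-1}-e_d)$. Set $\Delta(\Sigma_d)=\{S\subset[3d-1]\mid \mathrm{Cone}(V_i\mid i\in S)\in\Sigma_d\}$. Pellspace. Let $u_1,\dots,u_{3d-1}$ be the coordinates on $\mathbb C^{3d-1}$ and write $a_i=u_i$ $(1\le i\le d)$, $b_i=u_{d+i}$ $(1\le i\le d)$, $c_i=u_{2d+i}$ $(1\le i\le d-1)$, with the convention $a_0=b_{d+1}=c_0=c_d=1$. The Pellspace $\widetilde{\mathcal U}_d$ is the vanishing locus in $\mathbb C^{3d-1}$ of the $3d-1$ equations $a_i+b_ib_{i+1}c_{i-1}=1$ $(1\le i\le d)$, $b_i+a_{i-1}a_ic_i=1$ $(1\le i\le d)$, $c_i+b_ia_{i+1}c_{i-1}c_{i+1}=1$ $(1\le i\le d-1)$. *)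

(* Defs.v *)
(* R is any model of the real numbers; the complex numbers are R[i]. *)
From HB Require Import structures.
From mathcomp Require Import all_boot all_order all_algebra.
From mathcomp Require Import boolp classical_sets reals complex mpoly.

Set Implicit Arguments.
Unset Strict Implicit.
Unset Printing Implicit Defensive.

Import Order.TTheory GRing.Theory Num.Theory.
Local Open Scope classical_set_scope.
Local Open Scope ring_scope.

(* The set [n] = {1, ..., n} is represented by 'I_n: the ordinal i stands for
   i.+1. Functions of a nat index k below follow the 1-based numbering. *)

Definition is_complex (n : nat) (D : {set {set 'I_n}}) : Prop :=
  D != finset.set0 /\
  forall S T : {set 'I_n}, S \in D -> T \subset S -> T \in D.

Definition incompatible (n : nat) (D : {set {set 'I_n}}) (i j : 'I_n) : bool :=
  [set i; j]%SET \notin D.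

Definition is_flag_complex (n : nat) (D : {set {set 'I_n}}) : Prop :=
  [/\ is_complex D,
      forall k : 'I_n, [set k]%SET \in D
    & forall S : {set 'I_n},
        (forall i j, i \in S -> j \in S -> i != j -> [set i; j]%SET \in D) ->
        S \in D].

Section Varieties.
Variables (K : fieldType) (n : nat).
Implicit Types (X Y A B : set 'rV[K]_n).

Definition zero_locus (I : set {mpoly K[n]}) : set 'rV[K]_n :=
  [set u | forall p, I p -> p.@[u 0] = 0].

Definition zariski_closed X : Prop := exists I, X = zero_locus I.

Definition irreducible X : Prop :=
  X !=set0 /\
  forall A B, zariski_closed A -> zariski_closed B ->
    X `<=` A `|` B -> X `<=` A \/ X `<=` B.

(* Z 0 < Z 1 < ... < Z k, all closed and irreducible *)
Definition irreducible_chain (k : nat) (Z : nat -> set 'rV[K]_n) : Prop :=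
  (forall i, (i <= k)%N -> zariski_closed (Z i) /\ irreducible (Z i)) /\
  (forall i, (i < k)%N -> Z i `<` Z i.+1).

(* Krull dimension and codimension, for X closed: the irreducible closed
   subsets of X are then those of the ambient space contained in X. *)
Definition has_dim X (k : nat) : Prop :=
  (exists2 Z, irreducible_chain k Z & Z k `<=` X) /\
  (forall l Z, irreducible_chain l Z -> Z l `<=` X -> (l <= k)%N).

Definition has_codim Y X (k : nat) : Prop :=
  (exists Z, [/\ irreducible_chain k Z, Z 0%N = Y & Z k `<=` X]) /\
  (forall l Z, irreducible_chain l Z -> Z 0%N = Y -> Z l `<=` X -> (l <= k)%N).

Definition stratum X (S : {set 'I_n}) : set 'rV[K]_n :=
  [set u | X u /\ forall i, i \in S -> u 0 i = 0].

(* p = 0 is a u-equation for i *)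
Definition is_u_equation (D : {set {set 'I_n}}) (i : 'I_n) (p : {mpoly K[n]}) :
    Prop :=
  exists a : 'I_n -> nat,
    (forall j, incompatible D i j -> (0 < a j)%N) /\
    p = 'X_i + \prod_(j | incompatible D i j) 'X_j ^+ a j - 1.

Definition is_binary_geometry (D : {set {set 'I_n}}) (U : set 'rV[K]_n) : Prop :=
  [/\ exists2 r : 'I_n -> {mpoly K[n]},
        forall i, is_u_equation D i (r i) & U = zero_locus (range r),
      has_dim U (\max_(S in D) #|S|),
      forall S : {set 'I_n}, stratum U S !=set0 <-> S \in D
    & forall S : {set 'I_n}, stratum U S !=set0 ->
        irreducible (stratum U S) /\ has_codim (stratum U S) U #|S|].

End Varieties.

Section Polyhedra.
Variables (R : realType) (d : nat).
Implicit Types (P F : set 'rV[R]_d) (w x : 'rV[R]_d).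

Definition dotp w x : R := \sum_(i < d) w 0 i * x 0 i.

Definition exponent_vector (m : 'X_{1..d}) : 'rV[R]_d := \row_i (m i)%:R.

Definition newton_polytope (K : nzRingType) (f : {mpoly K[d]}) : set 'rV[R]_d :=
  [set x | exists l : 'X_{1..d} -> R,
     [/\ forall m, 0 <= l m, \sum_(m <- msupp f) l m = 1
       & x = \sum_(m <- msupp f) l m *: exponent_vector m]].

Definition face P w : set 'rV[R]_d :=
  [set x | P x /\ forall y, P y -> dotp w x <= dotp w y].

Definition normal_cone P F : set 'rV[R]_d := [set w | F `<=` face P w].

Definition inner_normal_fan P : set (set 'rV[R]_d) :=
  [set N | exists2 F, (exists w, F = face P w) & N = normal_cone P F].

Definition cone (n : nat) (V : 'I_n -> 'rV[R]_d) (S : {set 'I_n}) :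
    set 'rV[R]_d :=
  [set x | exists2 l : 'I_n -> R, (forall i, 0 <= l i) &
     x = \sum_(i in S) l i *: V i].

Definition fan_complex (n : nat) (V : 'I_n -> 'rV[R]_d)
    (Sigma : set (set 'rV[R]_d)) : {set {set 'I_n}} :=
  [set S : {set 'I_n} | `[< Sigma (cone V S) >]]%SET.

End Polyhedra.

(* The variable with 1-based number k, for 1 <= k <= n *)
Definition mvar (K : nzRingType) (n k : nat) : {mpoly K[n]} :=
  if insub k.-1 is Some i then 'X_i else 0.
Arguments mvar : clear implicits.

Section Pell.
Variables (R : realType) (d : nat).

Definition pell_poly : {mpoly R[d]} :=
  let y := mvar R d in
  \prod_(1 <= i < d.+1) (1 + y i) *
  \prod_(1 <= j < d) (1 + y j + y j * y j.+1).

Definition pellytope : set 'rV[R]_d := newton_polytope pell_poly.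

Definition basis_vector (k : nat) : 'rV[R]_d := \row_(j < d) (j.+1 == k)%:R.

Definition pell_ray (i : 'I_(3 * d - 1)) : 'rV[R]_d :=
  let k := i.+1 in
  if (k <= d)%N then basis_vector k
  else if (k <= 2 * d)%N then - basis_vector (k - d)
  else basis_vector (k - 2 * d) - basis_vector (k - 2 * d).+1.

Definition pell_complex : {set {set 'I_(3 * d - 1)}} :=
  fan_complex pell_ray (inner_normal_fan pellytope).

Definition pell_a (k : nat) : {mpoly R[i][3 * d - 1]} :=
  if k == 0%N then 1 else mvar _ _ k.

Definition pell_b (k : nat) : {mpoly R[i][3 * d - 1]} :=
  if k == d.+1 then 1 else mvar _ _ (d + k).

Definition pell_c (k : nat) : {mpoly R[i][3 * d - 1]} :=
  if (k == 0%N) || (k == d) then 1 else mvar _ _ (2 * d + k).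

Definition pell_equation (i : 'I_(3 * d - 1)) : {mpoly R[i][3 * d - 1]} :=
  let a := pell_a in let b := pell_b in let c := pell_c in
  if (i.+1 <= d)%N then
    let k := i.+1 in a k + b k * b k.+1 * c k.-1 - 1
  else if (i.+1 <= 2 * d)%N then
    let k := (i.+1 - d)%N in b k + a k.-1 * a k * c k - 1
  else
    let k := (i.+1 - 2 * d)%N in c k + b k * a k.+1 * c k.-1 * c k.+1 - 1.

Definition pellspace : set 'rV[R[i]]_(3 * d - 1) :=
  zero_locus (range pell_equation).

End Pell.

Arguments pell_complex : clear implicits.
Arguments pellspace : clear implicits.

(* Main.v *)
From HB Require Import structures.
From mathcomp Require Import all_boot all_order all_algebra.
From mathcomp Require Import boolp classical_sets reals complex mpoly.
From mathcomp Require Import ring lra zify.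
Require Import Defs.

Set Implicit Arguments.
Unset Strict Implicit.
Unset Printing Implicit Defensive.

Import Order.TTheory GRing.Theory Num.Theory.

(** Call two variables incompatible when one occurs in the monomial of the
u-equation of the other; a clique is a set of pairwise compatible variables.

The fan. Every vector x of R^d has a unique expression with nonnegative
coefficients on the rays e_k, -e_k, e_k - e_(k+1) whose support is a clique:
the coefficient of e_k - e_(k+1) is min(x_k^+, x_(k+1)^-), and those of e_k and
-e_k are what remains of x_k^+ and x_k^- ([ray_coef_sum], [ray_coef_comb]).
The polytope is a Minkowski sum, so w' belongs to the normal cone of the face
selected by w exactly when, on each factor 1 + y_k and 1 + y_j + y_j y_(j+1), the
exponents minimizing w also minimize w'. These conditions are sign conditions
on w_k and w_j + w_(j+1), and they say that every ray with coefficient 0 in w has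
coefficient 0 in w' ([refines_zero_sub]). Hence the cones of the fan are the
cones over cliques ([pell_complexE]), which gives flagness, and the u-equations
have the required shape.

The variety. Put p_k = a_k c_k, with p_0 = 1 and p_(d+1) = 0. The defining
equations turn into d + 1 links, the k-th one relating only p_k,
p_(k+1), a_k, b_(k+1), c_k ([pellspace_links]). Its main consequences are
c_k = 1 - (1 - p_k) p_(k+1), a_k c_k = p_k and b_(k+1) c_k = 1 - p_(k+1). Where
c_k is nonzero, the link is determined by p_k and p_(k+1); where c_k = 0, it
says p_k = 0, p_(k+1) = 1 and a_k + b_(k+1) = 1. On the part of a stratum U_S
where c_k vanishes for c_k in S only, the stratum therefore is an open piece of an
affine space, in which any two points lie on a line. Any point of U_S moves
into that part along a rational curve ([chart_dense]). A nonzero rational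
function of one variable has finitely many zeros, so these curves prove that
U_S is irreducible ([stratum_irreducible]). Integer values of the p_k give
a point of U_S whose zero coordinates are exactly those in S
([stratum_point]); so U_S is nonempty for every clique S and the inclusions
between strata are strict.

Dimensions. Let the rank of a closed set be the largest number of polynomials
that are algebraically independent on it. It increases strictly along a
strict inclusion of a closed set into an irreducible one ([has_indepS]). It is at most d on U,
because on a dense part all coordinates are rational functions of p_1, ..., p_d
([pellspace_indep]). Every clique lies in a clique with at least d elements,
because the fan is complete ([clique_facet]), so the rank of U_S is at least
d - #S. A chain from U_S upwards in U has therefore at most #S steps, and
adding the strata one variable at a time gives a chain with #S steps. *)

(** * Codes of the variables and incompatibility *)

(** The variables are numbered as the coordinates of the ambient space: a_k has
code k, b_k has code d + k and c_k has code 2 * d + k. The list holds the codes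
of the variables in the monomial of the u-equation of the variable x; the
variables a_0, b_(d+1), c_0 and c_d, which stand for 1, are left out. *)
Definition nbrs (d x : nat) : seq nat :=
  if (x <= d)%N then
    [:: d + x] ++ (if x < d then [:: d + x.+1] else [::]) ++
    (if 1 < x then [:: 2 * d + x.-1] else [::])
  else if (x <= 2 * d)%N then
    (if 1 < x - d then [:: (x - d).-1] else [::]) ++ [:: x - d] ++
    (if x - d < d then [:: d + x] else [::])
  else
    [:: x - d; (x - 2 * d).+1] ++
    (if 1 < x - 2 * d then [:: x.-1] else [::]) ++
    (if (x - 2 * d).+1 < d then [:: x.+1] else [::]).

Definition incomp d x y := y \in nbrs d x.

Section Combi.
Variable d : nat.

Lemma nbrs_aE k : 1 <= k <= d -> nbrs d k =
  [:: d + k] ++ (if k < d then [:: d + k.+1] else [::]) ++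
  (if 1 < k then [:: 2 * d + k.-1] else [::]).
Proof. by move=> /andP [k1 kd]; rewrite /nbrs kd. Qed.

Lemma nbrs_bE k : 1 <= k <= d -> nbrs d (d + k) =
  (if 1 < k then [:: k.-1] else [::]) ++ [:: k] ++
  (if k < d then [:: 2 * d + k] else [::]).
Proof.
move=> /andP [k1 kd]; rewrite /nbrs addKn.
have -> : (d + k <= d) = false by lia.
have -> : d + k <= 2 * d by lia.
by have -> : d + (d + k) = 2 * d + k by lia.
Qed.

Lemma nbrs_cE k : 1 <= k < d -> nbrs d (2 * d + k) =
  [:: d + k; k.+1] ++ (if 1 < k then [:: 2 * d + k.-1] else [::]) ++
  (if k.+1 < d then [:: 2 * d + k.+1] else [::]).
Proof.
move=> /andP [k1 kd]; rewrite /nbrs addKn.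
have -> : (2 * d + k <= d) = false by lia.
have -> : (2 * d + k <= 2 * d) = false by lia.
have -> : 2 * d + k - d = d + k by lia.
have -> : (2 * d + k).+1 = 2 * d + k.+1 by lia.
by have -> : (2 * d + k).-1 = 2 * d + k.-1 by lia.
Qed.

Lemma incomp_aE k y : 1 <= k <= d ->
  incomp d k y = [|| y == d + k, (k < d) && (y == d + k.+1) | (1 < k) && (y == 2 * d + k.-1)].
Proof.
move=> kd; rewrite /incomp nbrs_aE // !mem_cat inE.
by case: ifP => _; case: ifP => _; rewrite ?inE ?andbT ?orbF.
Qed.

Lemma incomp_bE k y : 1 <= k <= d ->
  incomp d (d + k) y = [|| y == k, (1 < k) && (y == k.-1) | (k < d) && (y == 2 * d + k)].
Proof.
move=> kd; rewrite /incomp nbrs_bE // !mem_cat inE orbCA.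
by case: ifP => _; case: ifP => _; rewrite ?inE ?andbT ?orbF.
Qed.

Lemma incomp_cE k y : 1 <= k < d ->
  incomp d (2 * d + k) y =
    [|| y == d + k, y == k.+1, (1 < k) && (y == 2 * d + k.-1) | (k.+1 < d) && (y == 2 * d + k.+1)].
Proof.
move=> kd; rewrite /incomp nbrs_cE // !mem_cat !inE -orbA; do 2 congr (_ || _).
by case: ifP => _; case: ifP => _; rewrite ?inE ?andbT ?orbF.
Qed.

(** Every coordinate is an a_k, a b_k or a c_k. All statements on coordinates are
proved by this case analysis and by linear arithmetic on codes. *)
Variant code_spec : nat -> Prop :=
| CodeA k of (1 <= k <= d)%N : code_spec k
| CodeB k of (1 <= k <= d)%N : code_spec (d + k)
| CodeC k of (1 <= k < d)%N : code_spec (2 * d + k).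

Lemma codeP (i : 'I_(3 * d - 1)) : code_spec i.+1.
Proof.
have [h1|h1] := leqP i.+1 d; first by constructor; rewrite h1.
have [h2|h2] := leqP i.+1 (2 * d).
  have -> : i.+1 = (d + (i.+1 - d))%N by lia.
  by constructor; lia.
have -> : i.+1 = (2 * d + (i.+1 - 2 * d))%N by lia.
by constructor; have := ltn_ord i; lia.
Qed.

Lemma nbrs_uniq (i : 'I_(3 * d - 1)) : uniq (nbrs d i.+1).
Proof.
case: (codeP i) => k kd; rewrite ?(nbrs_aE kd) ?(nbrs_bE kd) ?(nbrs_cE kd);
  by do 2 case: ifP => ?; rewrite /= ?inE; lia.
Qed.

Lemma nbrs_code (i : 'I_(3 * d - 1)) : all (fun x => 1 <= x <= 3 * d - 1) (nbrs d i.+1).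
Proof.
case: (codeP i) => k kd; rewrite ?(nbrs_aE kd) ?(nbrs_bE kd) ?(nbrs_cE kd);
  by do 2 case: ifP => ?; rewrite /=; lia.
Qed.

Lemma incomp_sym (i j : 'I_(3 * d - 1)) : incomp d i.+1 j.+1 = incomp d j.+1 i.+1.
Proof.
case: (codeP i) => k hk; case: (codeP j) => l hl;
 rewrite ?(incomp_aE _ hk) ?(incomp_bE _ hk) ?(incomp_cE _ hk)
   ?(incomp_aE _ hl) ?(incomp_bE _ hl) ?(incomp_cE _ hl); lia.
Qed.

Lemma incomp_irr (i : 'I_(3 * d - 1)) : incomp d i.+1 i.+1 = false.
Proof.
by case: (codeP i) => k hk;
 rewrite ?(incomp_aE _ hk) ?(incomp_bE _ hk) ?(incomp_cE _ hk); lia.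
Qed.

End Combi.

Local Open Scope ring_scope.

(** * Algebraic independence and chains of irreducible closed sets *)

Section Indep.
Variables (K : fieldType).

Lemma widen_ord_lift k (i : 'I_k) : widen_ord (leqnSn k) i = lift ord_max i.
Proof. by apply/val_inj; rewrite /= /bump leqNgt ltn_ord. Qed.

(** A polynomial in k + 1 variables is recovered from its coefficients as a
polynomial in the last variable. *)
Lemma coef_muni k (P : {mpoly K[k.+1]}) (m : 'X_{1..k.+1}) :
  m \in msupp P ->
  ((muni P)`_(m ord_max))@_[multinom m (widen_ord (leqnSn k) i) | i < k] = P@_m.
Proof.
move=> mP; rewrite muniE coef_sum raddf_sum /= (bigD1_seq m) //=.
rewrite !coefZ coefXn eqxx mulr1 mcoeffZ mcoeffX eqxx mulr1.
rewrite big1 ?addr0 // => m' nm'; rewrite !coefZ coefXn.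
case: eqP => [em|_]; last by rewrite mulr0 mcoeff0.
rewrite mulr1 mcoeffZ mcoeffX; case: eqP => [em'|_]; last by rewrite mulr0.
case/eqP: nm'; apply/mnmP => i; case: (unliftP ord_max i) => [j|] ->; last by [].
move/mnmP/(_ j): em'; rewrite !mnmE.
by rewrite widen_ord_lift.
Qed.

Lemma muni_eq0 k (P : {mpoly K[k.+1]}) : muni P = 0 -> P = 0.
Proof.
move=> P0; apply/mpolyP => m; rewrite mcoeff0; apply/eqP.
rewrite mcoeff_eq0; apply/negP => mP.
by have := coef_muni mP; rewrite P0 coef0 mcoeff0 => /esym/eqP; rewrite mcoeff_eq0 mP.
Qed.

Lemma meval_muni k (P : {mpoly K[k.+1]}) (v : 'I_k.+1 -> K) :
  P.@[v] = (map_poly (meval (fun i => v (widen_ord (leqnSn k) i))) (muni P)).[v ord_max].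
Proof.
rewrite mevalE muniE rmorph_sum horner_sum; apply: eq_bigr => m _ /=.
rewrite big_ord_recr /= map_polyZ /= map_polyXn hornerZ hornerXn mulrA.
rewrite mevalZ mevalX; do 2 congr (_ * _); apply: eq_bigr => i _; by rewrite mnmE.
Qed.

Section Var.
Variable n : nat.
Implicit Types (Z X Y : set 'rV[K]_n).

Definition alg_indep Z k (f : 'I_k -> {mpoly K[n]}) : Prop :=
  forall P : {mpoly K[k]},
    (forall u, Z u -> P.@[fun i => (f i).@[u 0]] = 0) -> P = 0.

(** For Z closed and irreducible, the largest such k is the transcendence degree of
its function field. *)
Definition has_indep Z k : Prop := exists f : 'I_k -> {mpoly K[n]}, alg_indep Z f.

Lemma has_indep0 Z : (Z !=set0)%classic -> has_indep Z 0.
Proof.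
case=> u Zu; exists (fun _ => 0) => P /(_ u Zu).
have -> : P = (P@_0)%:MP.
  apply/mpolyP => m; rewrite mcoeffC.
  have -> : m = 0%MM by apply/mnmP; case.
  by rewrite eqxx mulr1.
by rewrite mevalC => ->; rewrite mpolyC0.
Qed.

Lemma has_indep_sub Z Z' k : (Z `<=` Z')%classic -> has_indep Z k -> has_indep Z' k.
Proof. by move=> sZ [f fi]; exists f => P PZ; apply: fi => u /sZ /PZ. Qed.

Lemma closed_poly (p : {mpoly K[n]}) : zariski_closed [set u : 'rV[K]_n | p.@[u 0] = 0]%classic.
Proof.
exists [set p]%classic; apply/seteqP; split => [u /= pu _ -> //|u /=]; exact.
Qed.

Lemma irreducible_mul X (p q : {mpoly K[n]}) : irreducible X ->
  (forall u, X u -> p.@[u 0] * q.@[u 0] = 0) ->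
  (forall u, X u -> p.@[u 0] = 0) \/ (forall u, X u -> q.@[u 0] = 0).
Proof.
case=> _ /(_ _ _ (closed_poly p) (closed_poly q)) irr pq.
case: irr => [u /pq /eqP||]; [|by left|by right].
by rewrite mulf_eq0 => /orP [] /eqP; [left|right].
Qed.

Lemma irreducible_expl X (p q : {mpoly K[n]}) m : irreducible X ->
  (forall u, X u -> p.@[u 0] ^+ m * q.@[u 0] = 0) ->
  (forall u, X u -> p.@[u 0] = 0) \/ (forall u, X u -> q.@[u 0] = 0).
Proof.
move=> iX; elim: m => [|m IH] h.
  by right => u /h; rewrite expr0 mul1r.
case: (@irreducible_mul X p (p ^+ m * q) iX) => [u Xu||h']; [|by left|].
  by rewrite mevalM rmorphXn mulrA -exprS h.
by apply: IH => u /h'; rewrite mevalM rmorphXn.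
Qed.

(** A point outside a closed set is separated from it by one polynomial, so
irreducibility can be tested on hypersurfaces. *)
Lemma zariski_closed_nonzero Z u : zariski_closed Z -> ~ Z u ->
  exists2 g : {mpoly K[n]}, (forall v, Z v -> g.@[v 0] = 0) & g.@[u 0] != 0.
Proof.
case=> I -> nZ; apply: contrapT => h; apply: nZ => p Ip.
by apply/eqP/negP => /negP pu; apply: h; exists p => // v; apply.
Qed.

(** A polynomial g that vanishes on Z but not on Z' is independent of the f_i on
Z'. In a relation Q(f, g) = 0 on Z', the largest power of g can be divided out,
since Z' is irreducible and g does not vanish on it. On Z, where g = 0, only
the constant term in g is left; it is a nonzero relation between the f_i. *)
Lemma has_indepS Z Z' k : zariski_closed Z -> irreducible Z' ->
  (Z `<` Z')%classic -> has_indep Z k -> has_indep Z' k.+1.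
Proof.
move=> cZ iZ' [sZ /existsNP [u /not_implyP [Z'u nZu]]] [f fi].
have [g gZ gu] := zariski_closed_nonzero cZ nZu.
exists (fun i => oapp f g (unlift ord_max i)) => P PZ'.
have PE v : P.@[fun i => (oapp f g (unlift ord_max i)).@[v]] =
   (map_poly (meval (fun i => (f i).@[v])) (muni P)).[g.@[v]].
  rewrite meval_muni unlift_none /=; congr (_.[_]); apply: eq_map_poly => q /=.
  apply: meval_eq => i.
  by rewrite widen_ord_lift liftK.
apply: muni_eq0; apply/eqP/negP => /negP Q0.
set Q := muni P in PE Q0.
(* The power of the last variable to divide out. *)
pose j := find (fun c => c != 0) Q.
have hasQ : has (fun c => c != 0) Q.
  apply/(has_nthP 0); exists (size Q).-1; first by rewrite prednK // size_poly_gt0.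
  by rewrite -lead_coefE lead_coef_eq0.
have Qj : Q`_j != 0 := nth_find 0 hasQ.
have QE : Q = 'X^j * drop_poly j Q.
  rewrite mulrC -[LHS](poly_take_drop j) [X in X + _](_ : _ = 0) ?add0r //.
  apply/polyP => i; rewrite coef_take_poly coef0; case: ifP => // /(before_find 0).
  by move/negbFE/eqP.
pose q : {mpoly K[n]} :=
  \sum_(i < size (drop_poly j Q)) ((drop_poly j Q)`_i \mPo [tuple f i | i < k]) * g ^+ i.
have qE v : q.@[v] = (map_poly (meval (fun i => (f i).@[v])) (drop_poly j Q)).[g.@[v]].
  rewrite raddf_sum /= [in RHS]/map_poly horner_poly; apply: eq_bigr => i _ /=.
  rewrite mevalM rmorphXn comp_mpoly_meval; congr (_ * _).
  by apply: meval_eq => l; rewrite tnth_mktuple.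
have [v Z'v||q0] := @irreducible_expl Z' g q j iZ'.
- by rewrite -[RHS](PZ' v Z'v) PE QE rmorphM /= map_polyXn hornerM hornerXn qE.
- by move/(_ u Z'u)/eqP; rewrite (negbTE gu).
case/eqP: Qj; apply: fi => v Zv.
have := q0 v (sZ v Zv); rewrite qE (gZ v Zv) horner_coef0 coef_map /=.
by rewrite coef_drop_poly add0n.
Qed.

Lemma chain_indep l (Z : nat -> set 'rV[K]_n) k : irreducible_chain l Z ->
  has_indep (Z 0%N) k -> has_indep (Z l) (k + l).
Proof.
case=> cZ sZ h0.
have : forall i, (i <= l)%N -> has_indep (Z i) (k + i).
  elim=> [|i IH] il; first by rewrite addn0.
  rewrite addnS; have [_ iZ] := cZ _ il; have [cl _] := cZ _ (ltnW il).
  exact: (has_indepS cl iZ (sZ _ il)) (IH (ltnW il)).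
exact.
Qed.

End Var.

Lemma card_bmultinom d b : (#|{: 'X_{1..d < b.+1}}| <= b.+1 ^ d)%N.
Proof.
have fP (m : 'X_{1..d < b.+1}) i : (m i < b.+1)%N.
  by apply: leq_ltn_trans (bmdeg m); rewrite mdegE (bigD1 i) //= leq_addr.
rewrite -[X in (X ^ _)%N]card_ord -[X in (_ ^ X)%N](card_ord d) -card_ffun.
apply: (@leq_card _ _ (fun m : 'X_{1..d < b.+1} => [ffun i : 'I_d => Ordinal (fP m i)])).
move=> m1 m2 /ffunP e; apply/val_inj/mnmP => i.
by have := congr1 val (e i); rewrite !ffunE.
Qed.

Lemma linear_dependence (I J : finType) (A : I -> J -> K) : (#|J| < #|I|)%N ->
  exists2 l : I -> K, (exists i, l i != 0) & forall j, \sum_i l i * A i j = 0.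
Proof.
move=> JI; pose M := \matrix_(i < #|I|, j < #|J|) A (enum_val i) (enum_val j).
have : kermx M != 0.
  by rewrite -mxrank_eq0 mxrank_ker -lt0n subn_gt0 (leq_ltn_trans (rank_leq_col _)).
case/rowV0Pn => v /sub_kermxP vM v0.
exists (fun i => v 0 (enum_rank i)).
  by have [i vi] := rV0Pn _ v0; exists (enum_val i); rewrite enum_valK.
move=> j; have := congr1 (fun B : 'rV_#|J| => B 0 (enum_rank j)) vM; rewrite !mxE => vMj; rewrite -[RHS]vMj.
rewrite (reindex (@enum_val I I)) /=; last first.
  by exists enum_rank => i _; rewrite ?enum_valK ?enum_rankK.
by apply: eq_bigr => i _; rewrite mxE enum_valK enum_rankK.
Qed.

(** The bounds are shifted by one because [msize] is the degree plus one. *)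
Lemma msizeM_leS d (p q : {mpoly K[d]}) b c :
  (msize p <= b.+1)%N -> (msize q <= c.+1)%N -> (msize (p * q) <= (b + c).+1)%N.
Proof.
have [->|p0] := eqVneq p 0; first by rewrite mul0r msize0.
have [->|q0] := eqVneq q 0; first by rewrite mulr0 msize0.
by rewrite (msizeM p0 q0); move: (msize p) (msize q) => s1 s2; lia.
Qed.

Lemma msizeX_le d (p : {mpoly K[d]}) b e : (msize p <= b.+1)%N -> (msize (p ^+ e) <= (b * e).+1)%N.
Proof.
move=> pb; elim: e => [|e IH]; first by rewrite expr0 msize1.
by rewrite exprS mulnS msizeM_leS.
Qed.

(** The products over j of F_j^(a_j) G^(N - a_j), for exponents a_j <= N, are
(N + 1)^m polynomials of degree at most b m N, where b bounds the degrees of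
the F_j and of G. They lie in a space of dimension at most (b m N + 1)^d, which
is smaller for large N since d < m. A linear relation between them, divided
by G^(m N), is a polynomial relation between the F_j / G. *)
Lemma algebraic_dependence d m (F : 'I_m -> {mpoly K[d]}) (G : {mpoly K[d]}) : (d < m)%N ->
  exists2 P : {mpoly K[m]}, P != 0 & forall x : 'I_d -> K, G.@[x] != 0 ->
    P.@[fun j => (F j).@[x] / G.@[x]] = 0.
Proof.
move=> dm.
pose b := (msize G + \sum_j msize (F j))%N.
have Gb : (msize G <= b.+1)%N by rewrite /b; lia.
have Fb j : (msize (F j) <= b.+1)%N by rewrite /b (bigD1 j) //=; lia.
(* With this N, (b m N + 1)^d <= (b m + 1)^d (N + 1)^d = N (N + 1)^d < (N + 1)^(d + 1). *)
pose N := ((b * m).+1 ^ d)%N.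
pose I := {ffun 'I_m -> 'I_N.+1}.
pose Hm (a : I) := \prod_j (F j ^+ a j * G ^+ (N - a j)).
pose B := (b * m * N)%N.
have HmB a : (msize (Hm a) <= B.+1)%N.
  rewrite /Hm /B -[X in (b * X * _)%N]card_ord -sum1_card big_distrr big_distrl /=.
  elim/big_ind2: _ => [|n1 p1 n2 p2|j _]; [by rewrite msize1|exact: msizeM_leS|].
  have aN : (a j <= N)%N by rewrite -ltnS.
  rewrite muln1 -[X in (_ <= (_ * X).+1)%N](subnKC aN) mulnDr.
  by apply: msizeM_leS; apply: msizeX_le.
have [|l [a0 la0] lE] := @linear_dependence I 'X_{1..d < B.+1} (fun a (mo : 'X_{1..d < B.+1}) => (Hm a)@_mo).
  apply: leq_ltn_trans (card_bmultinom d B) _; rewrite /I card_ffun !card_ord.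
  apply: (@leq_trans (N.+1 ^ d.+1)); last by rewrite leq_exp2l // /N; lia.
  rewrite expnS; apply: (@leq_ltn_trans (N * N.+1 ^ d)).
    have BN : (B.+1 <= (b * m).+1 * N.+1)%N by rewrite /B; nia.
    by rewrite -expnMn; case: (d) => [//|e]; rewrite leq_exp2r.
  by rewrite ltn_pmul2r ?expn_gt0.
pose P : {mpoly K[m]} := \sum_a l a *: 'X_[[multinom a i : nat | i < m]].
exists P.
  apply/negP => /eqP /(congr1 (mcoeff [multinom a0 i : nat | i < m])) /eqP.
  rewrite mcoeff0 raddf_sum (bigD1 a0) //= mcoeffZ mcoeffX eqxx mulr1 big1 ?addr0 ?(negbTE la0) //.
  move=> a na; rewrite mcoeffZ mcoeffX; case: eqP => [/mnmP e|_]; last by rewrite mulr0.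
  by case/eqP: na; apply/ffunP => i; have := e i; rewrite !mnmE => /val_inj.
move=> x Gx.
have : (\sum_a l a *: Hm a).@[x] = 0.
  suff -> : \sum_a l a *: Hm a = 0 by rewrite meval0.
  apply/mpolyP => mo; rewrite mcoeff0 raddf_sum /=.
  have [moB|moB] := ltnP (mdeg mo) B.+1.
    by rewrite -[RHS](lE (BMultinom moB)); apply: eq_bigr => a _; rewrite mcoeffZ.
  rewrite big1 // => a _; rewrite mcoeffZ; apply/eqP; rewrite mulf_eq0; apply/orP; right.
  by rewrite mcoeff_eq0 msize_mdeg_ge // (leq_trans (HmB a)).
rewrite !raddf_sum /= => E.
apply: (mulfI (expf_neq0 (m * N)%N Gx)); rewrite mulr0 -[RHS]E mulr_sumr.
apply: eq_bigr => a _; rewrite !mevalZ mulrCA; congr (_ * _).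
rewrite mevalX /Hm rmorph_prod /= exprM.
have -> : (G.@[x] ^+ m) ^+ N = \prod_(j < m) G.@[x] ^+ N.
  by rewrite prodr_const card_ord exprAC.
rewrite -big_split; apply: eq_bigr => j _ /=.
rewrite mnmE rmorphM !rmorphXn /= expr_div_n mulrCA; congr (_ * _).
have aN : (a j <= N)%N by rewrite -ltnS.
by rewrite -{1}(subnK aN) exprD mulfK ?expf_neq0.
Qed.
End Indep.

(** * Irreducibility by rational curves *)

Section Curves.
Variable K : numFieldType.

(** Reduces statements on all polynomial expressions in the x i to the x i
themselves; it serves for rational functions of a parameter and for functions on
a chart. *)
Lemma meval_closed n (T : Type) (x : T -> 'I_n -> K) (Q : (T -> K) -> Prop) :
  (forall c, Q (fun=> c)) -> (forall i, Q (fun t => x t i)) ->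
  (forall h k, Q h -> Q k -> Q (fun t => h t + k t)) ->
  (forall h k, Q h -> Q k -> Q (fun t => h t * k t)) ->
  forall p : {mpoly K[n]}, Q (fun t => p.@[x t]).
Proof.
move=> Qc Qx QD QM; elim/mpolyind => [|c m p _ _ Qp].
  by rewrite (_ : (fun _ => _) = fun=> 0); [exact: Qc|apply/funext => t; rewrite meval0].
rewrite (_ : (fun _ => _) = fun t => c * (\prod_(i < n) x t i ^+ m i) + p.@[x t]); last first.
  by apply/funext => t; rewrite mevalD mevalZ mevalX.
apply: (QD _ _ _ Qp); apply: (QM) => //.
elim: (index_enum _) => [|i s IH].
  by rewrite (_ : (fun _ => _) = fun=> 1); [exact: Qc|apply/funext => t; rewrite big_nil].
rewrite (_ : (fun _ => _) = fun t => x t i ^+ m i * \prod_(i <- s) x t i ^+ m i); last first.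
  by apply/funext => t; rewrite big_cons.
apply: (QM _ _ _ IH); elim: (m i) => [|e IHe].
  by rewrite (_ : (fun _ => _) = fun=> 1); [exact: Qc|apply/funext => t; rewrite expr0].
rewrite (_ : (fun _ => _) = fun t => x t i * x t i ^+ e); last by apply/funext => t; rewrite exprS.
exact: QM.
Qed.

(** The property holds for all but finitely many values of the parameter. *)
Definition generic (Q : K -> Prop) : Prop :=
  exists2 D : {poly K}, D != 0 & forall t, D.[t] != 0 -> Q t.

Lemma genericI P Q : generic P -> generic Q -> generic (fun t => P t /\ Q t).
Proof.
move=> [D D0 DP] [E E0 EQ]; exists (D * E); first exact: mulf_neq0.
by move=> t; rewrite hornerM mulf_eq0 negb_or => /andP [/DP ? /EQ].
Qed.

Lemma genericW (P Q : K -> Prop) : (forall t, P t -> Q t) -> generic P -> generic Q.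
Proof. by move=> PQ [D D0 DP]; exists D => // t /DP /PQ. Qed.

Lemma generic_all (Q : nat -> K -> Prop) m : (forall i, (i < m)%N -> generic (Q i)) ->
  generic (fun t => forall i, (i < m)%N -> Q i t).
Proof.
elim: m => [|m IH] h; first by exists 1; rewrite ?oner_eq0.
apply: genericW (genericI (IH (fun i im => h i (ltnW im))) (h m (ltnSn m))) => t [h1 h2] i.
by rewrite ltnS leq_eqVlt => /orP [/eqP ->|/h1].
Qed.

Lemma generic_ex Q : generic Q -> exists t, Q t.
Proof.
move=> [D D0 DQ]; have [t Dt] : exists t, D.[t] != 0; last by exists t; exact: DQ.
apply: contrapT => /forallNP h.
have rs : all (root D) [seq i%:R | i <- iota 0 (size D)].
  by apply/allP => t _; apply/negP => /negP /h.
have := max_poly_roots D0 rs; rewrite map_inj_uniq ?iota_uniq; last first.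
  by move=> i j /eqP; rewrite eqr_nat => /eqP.
by rewrite size_map size_iota ltnn => /(_ isT).
Qed.

(** The equality is required at t0 too: this is what carries an inequality at t0
over to generic parameters in [regular_nonzero]. *)
Definition regular_at (t0 : K) (h : K -> K) : Prop :=
  exists N D : {poly K}, D.[t0] != 0 /\ forall t, D.[t] != 0 -> h t = N.[t] / D.[t].

Section Regular.
Variable t0 : K.

Lemma regularC c : regular_at t0 (fun=> c).
Proof. by exists c%:P, 1; split=> [|t _]; rewrite !hornerC ?oner_eq0 ?divr1. Qed.

Lemma regular_id : regular_at t0 id.
Proof. by exists 'X, 1; split=> [|t _]; rewrite !hornerC ?oner_eq0 // hornerX divr1. Qed.

Lemma regularM h k : regular_at t0 h -> regular_at t0 k -> regular_at t0 (fun t => h t * k t).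
Proof.
move=> [N [D [D0 hE]]] [N' [D' [D0' kE]]]; exists (N * N'), (D * D').
rewrite hornerM mulf_neq0 //; split=> // t.
rewrite !hornerM mulf_eq0 negb_or => /andP [d d']; rewrite hE // kE //; by field; apply/andP.
Qed.

Lemma regularD h k : regular_at t0 h -> regular_at t0 k -> regular_at t0 (fun t => h t + k t).
Proof.
move=> [N [D [D0 hE]]] [N' [D' [D0' kE]]]; exists (N * D' + D * N'), (D * D').
rewrite hornerM mulf_neq0 //; split=> // t.
rewrite hornerD !hornerM mulf_eq0 negb_or => /andP [d d']; rewrite hE // kE //; by field; apply/andP.
Qed.

Lemma regularB h k : regular_at t0 h -> regular_at t0 k -> regular_at t0 (fun t => h t - k t).
Proof.
move=> rh rk; have := regularD rh (regularM (regularC (-1)) rk).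
by congr regular_at; apply/funext => t; rewrite mulN1r.
Qed.

Lemma regular_nonzero h : regular_at t0 h -> h t0 != 0 -> generic (fun t => h t != 0).
Proof.
move=> [N [D [D0 hE]]]; rewrite (hE t0) // mulf_eq0 negb_or => /andP [N0 _].
exists (N * D).
  by apply/eqP => /(congr1 (horner^~ t0)) /eqP; rewrite hornerM horner0 mulf_eq0 (negbTE N0) (negbTE D0).
move=> t; rewrite hornerM mulf_eq0 negb_or => /andP [n d]; rewrite hE //.
by rewrite mulf_neq0 ?invr_eq0.
Qed.

Lemma regularV h : regular_at t0 h -> h t0 != 0 -> regular_at t0 (fun t => (h t)^-1).
Proof.
move=> [N [D [D0 hE]]]; rewrite (hE t0) // mulf_eq0 negb_or => /andP [N0 _].
exists (D * D), (N * D); rewrite hornerM mulf_neq0 //; split=> // t.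
rewrite !hornerM mulf_eq0 negb_or => /andP [n d]; rewrite hE //; by field; apply/andP.
Qed.

Lemma regularF h k : regular_at t0 h -> regular_at t0 k -> k t0 != 0 ->
  regular_at t0 (fun t => h t / k t).
Proof. by move=> rh rk k0; apply: regularM => //; apply: regularV. Qed.

Lemma regular_meval n (x : K -> 'I_n -> K) (p : {mpoly K[n]}) :
  (forall i, regular_at t0 (fun t => x t i)) -> regular_at t0 (fun t => p.@[x t]).
Proof.
move=> rx; apply: (meval_closed (Q := regular_at t0)) => //.
- exact: regularC.
- exact: regularD.
- exact: regularM.
Qed.

End Regular.

(** If two closed sets cover X and none contains it, each has an equation that
does not vanish at some point of X; no point of X is then outside both
hypersurfaces. *)
Lemma irreducible_by_points n (X : set 'rV[K]_n) : (X !=set0)%classic ->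
  (forall (u v : 'rV[K]_n) (f g : {mpoly K[n]}), X u -> X v -> f.@[u 0] != 0 -> g.@[v 0] != 0 ->
    exists2 w : 'rV[K]_n, X w & f.@[w 0] != 0 /\ g.@[w 0] != 0) ->
  irreducible X.
Proof.
move=> X0 h; split=> // A B cA cB XAB.
apply: contrapT => /not_orP [/existsNP [u /not_implyP [Xu nA]] /existsNP [v /not_implyP [Xv nB]]].
have [f fA fu] := zariski_closed_nonzero cA nA.
have [g gB gv] := zariski_closed_nonzero cB nB.
have [w Xw [/eqP fw /eqP gw]] := h u v f g Xu Xv fu gv.
by case: (XAB w Xw) => [/fA|/gB].
Qed.

End Curves.

(** * Coefficients of a vector on the rays *)

Section Phi.
Variable R : realDomainType.
Implicit Types x : nat -> R.

Definition pos_part (t : R) := Num.max t 0.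
Definition neg_part (t : R) := Num.max (- t) 0.
(** Together with the two next definitions, these are the coefficients of x on the
rays e_k - e_(k+1), e_k and -e_k, x being extended by 0. If c_k is the
coefficient of e_k - e_(k+1), then x_k^+ = a_k + c_k and x_(k+1)^- = b_(k+1) + c_k.
One of a_k and b_(k+1) is 0, so c_k is the minimum. *)
Definition coef_c x k := Num.min (pos_part (x k)) (neg_part (x k.+1)).
Definition coef_a x k := pos_part (x k) - coef_c x k.
Definition coef_b x k := neg_part (x k) - coef_c x k.-1.

Lemma coef_c_ge0 x k : 0 <= coef_c x k.
Proof. by rewrite /coef_c le_min /pos_part /neg_part !le_max !lexx !orbT. Qed.
Lemma coef_a_ge0 x k : 0 <= coef_a x k.
Proof. by rewrite subr_ge0 ge_min lexx. Qed.
Lemma coef_b_ge0 x k : (0 < k)%N -> 0 <= coef_b x k.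
Proof. by case: k => // k _; rewrite subr_ge0 ge_min lexx orbT. Qed.

Lemma coef_decomp x k : x k = coef_a x k - coef_b x k + coef_c x k - coef_c x k.-1.
Proof.
transitivity (pos_part (x k) - neg_part (x k)); last by rewrite /coef_a /coef_b; ring.
by rewrite /pos_part /neg_part /Num.max; do 2 case: ltP => ?; lra.
Qed.

(* The maxima are split before the minima are unfolded, so that no hypothesis
   contains a conditional. *)
Ltac coef_cases := rewrite /coef_a /coef_b /coef_c /pos_part /neg_part /Num.max /=;
  (do ?case: ltP => ?); rewrite /Num.min; (do ?case: ltP => ?); lra.

Lemma coef_a_eq0 x k : coef_a x k = 0 <-> x k <= 0 \/ x k + x k.+1 <= 0.
Proof. by split; [|case]; coef_cases. Qed.

Lemma coef_b_eq0 x k : coef_b x k.+1 = 0 <-> 0 <= x k.+1 \/ 0 <= x k + x k.+1.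
Proof. by split; [|case]; coef_cases. Qed.

Lemma coef_c_eq0 x k : coef_c x k = 0 <-> x k <= 0 \/ 0 <= x k.+1.
Proof. by split; [|case]; coef_cases. Qed.

(** These three bounds leave a margin: a ray with coefficient 1 keeps a nonzero
coefficient after a small perturbation. *)
Lemma coef_a_ge1 x k : 1 <= coef_a x k -> 1 <= x k /\ 1 <= x k + x k.+1.
(* Naming the value keeps the hypothesis out of the case analysis. *)
Proof. by move: (erefl (coef_a x k)); move: {1 3}(coef_a x k) => t + h; coef_cases. Qed.

Lemma coef_b_ge1 x k : 1 <= coef_b x k.+1 -> x k.+1 <= -1 /\ x k + x k.+1 <= -1.
Proof. by move: (erefl (coef_b x k.+1)); move: {1 3}(coef_b x k.+1) => t + h; coef_cases. Qed.

Lemma coef_c_ge1 x k : 1 <= coef_c x k -> 1 <= x k /\ x k.+1 <= -1.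
Proof. by move: (erefl (coef_c x k)); move: {1 3}(coef_c x k) => t + h; coef_cases. Qed.

Lemma coef_ab_excl x k : coef_a x k.+1 = 0 \/ coef_b x k.+1 = 0.
Proof. by rewrite coef_a_eq0 coef_b_eq0; lra. Qed.

Lemma coef_ab1_excl x k : coef_a x k = 0 \/ coef_b x k.+1 = 0.
Proof. by rewrite coef_a_eq0 coef_b_eq0; lra. Qed.

Lemma coef_ac1_excl x k : coef_a x k.+1 = 0 \/ coef_c x k = 0.
Proof. by rewrite coef_a_eq0 coef_c_eq0; lra. Qed.

Lemma coef_bc_excl x k : coef_b x k.+1 = 0 \/ coef_c x k.+1 = 0.
Proof. by rewrite coef_b_eq0 coef_c_eq0; lra. Qed.

Lemma coef_cc_excl x k : coef_c x k = 0 \/ coef_c x k.+1 = 0.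
Proof. by rewrite !coef_c_eq0; lra. Qed.

Section Loc.
Variables a b c x : nat -> R.
Hypotheses (a0 : forall k, 0 <= a k) (b0 : forall k, 0 <= b k) (c0 : forall k, 0 <= c k).
Hypothesis xE : forall k, x k = a k - b k + c k - c k.-1.
Hypothesis ab : forall k, a k = 0 \/ b k = 0.
Hypothesis ab1 : forall k, a k = 0 \/ b k.+1 = 0.
Hypothesis ac1 : forall k, a k = 0 \/ c k.-1 = 0.
Hypothesis bc : forall k, b k = 0 \/ c k = 0.
Hypothesis cc : forall k, c k = 0 \/ c k.-1 = 0.

(** In x_k, a nonzero a_k or c_k never meets a nonzero b_k or c_(k-1), so nothing
cancels. *)
Lemma pos_comb k : pos_part (x k) = a k + c k.
Proof.
move: (a0 k) (b0 k) (c0 k) (c0 k.-1) (ab k) (ac1 k) (bc k) (cc k); rewrite xE /pos_part /Num.max.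
by case: ltP => ?; lra.
Qed.

Lemma neg_comb k : neg_part (x k) = b k + c k.-1.
Proof.
move: (a0 k) (b0 k) (c0 k) (c0 k.-1) (ab k) (ac1 k) (bc k) (cc k); rewrite xE /neg_part /Num.max.
by case: ltP => ?; lra.
Qed.

Lemma coef_c_comb k : coef_c x k = c k.
Proof.
rewrite /coef_c pos_comb neg_comb /=.
by move: (a0 k) (b0 k.+1) (ab1 k); rewrite /Num.min; case: ltP => ?; lra.
Qed.

Lemma coef_a_comb k : coef_a x k = a k.
Proof. by rewrite /coef_a coef_c_comb pos_comb addrK. Qed.

Lemma coef_b_comb k : coef_b x k = b k.
Proof. by rewrite /coef_b coef_c_comb neg_comb addrK. Qed.
End Loc.

(** The comparison of the minimizing exponents of w = x and w' = y, factor by factor: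
1 + y_k has exponents of weight 0 and x_k, and the factor 1 + y_k + y_k y_(k+1)
has exponents of weight 0, x_k and x_k + x_(k+1). *)
Definition refines d (x y : nat -> R) := forall k, (1 <= k <= d)%N ->
  [/\ (0 <= x k -> 0 <= y k), (x k <= 0 -> y k <= 0) &
      (k < d)%N -> [/\ (0 <= x k -> 0 <= x k + x k.+1 -> 0 <= y k /\ 0 <= y k + y k.+1),
        (x k <= 0 -> 0 <= x k.+1 -> y k <= 0 /\ 0 <= y k.+1) &
        (x k.+1 <= 0 -> x k + x k.+1 <= 0 -> y k.+1 <= 0 /\ y k + y k.+1 <= 0)]].

Definition zero_sub d (x y : nat -> R) := forall k, (1 <= k <= d)%N ->
  [/\ (coef_a x k = 0 -> coef_a y k = 0), (coef_b x k = 0 -> coef_b y k = 0) &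
      (k < d)%N -> coef_c x k = 0 -> coef_c y k = 0].

(** Both conditions are about the same signs. For instance x_k >= 0 means that b_k
and c_(k-1) are 0, x_k and x_k + x_(k+1) are both nonnegative exactly when b_k, c_(k-1)
and b_(k+1) are 0, and conversely a_k = 0 means that x_k or x_k + x_(k+1) is at
most 0. *)
Lemma refines_zero_sub d (x y : nat -> R) : x 0%N = 0 -> x d.+1 = 0 -> y 0%N = 0 -> y d.+1 = 0 ->
  refines d x y <-> zero_sub d x y.
Proof.
move=> x0 xd y0 yd; split => h k kd.
  have [h1 h2 h3] := h k kd; split.
  - rewrite !coef_a_eq0; have [kd'|kd'] := ltnP k d.
      by have [_ _ h4] := h3 kd'; lra.
    have -> : k = d by lia.
    rewrite xd yd !addr0; have -> : d = k by lia.
    by lra.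
  - case: k kd h1 h2 h3 => // k kd h1 h2 h3; rewrite !coef_b_eq0.
    have [/eqP k0|k0] := boolP (k == 0%N).
      by rewrite k0 x0 y0 !add0r -k0; lra.
    have [|_ _] := h k; first lia.
    by case; [lia|move=> *; lra].
  - move=> kd'; have [|h1' h2' _] := h k.+1; first lia.
    by rewrite !coef_c_eq0; lra.
have hc j : (j <= d)%N -> coef_c x j = 0 -> coef_c y j = 0.
  move=> jd; have [/eqP ->|j0] := boolP (j == 0%N); first by rewrite !coef_c_eq0 y0; lra.
  have [/eqP ->|jd'] := boolP (j == d); first by rewrite !coef_c_eq0 yd; lra.
  by have [|_ _] := h j; [lia|apply; lia].
have ge0 j : (1 <= j <= d)%N -> 0 <= x j -> 0 <= y j.
  case: j => // j jd xj; have [_ hb _] := h _ jd.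
  have /coef_b_eq0 : coef_b y j.+1 = 0 by apply: hb; apply/coef_b_eq0; left.
  have /coef_c_eq0 : coef_c y j = 0 by apply: hc; [lia|apply/coef_c_eq0; right].
  by lra.
have le0 j : (1 <= j <= d)%N -> x j <= 0 -> y j <= 0.
  move=> jd xj; have [ha _ _] := h _ jd.
  have /coef_a_eq0 : coef_a y j = 0 by apply: ha; apply/coef_a_eq0; left.
  have /coef_c_eq0 : coef_c y j = 0 by apply: hc; [lia|apply/coef_c_eq0; left].
  by lra.
split; [exact: ge0|exact: le0|move=> kd'; have kd1 : (1 <= k.+1 <= d)%N by lia].
have [ha _ _] := h _ kd; have [_ hb1 _] := h _ kd1.
split=> [x1 x2|x1 x2|x1 x2].
- have := ge0 _ kd x1.
  have /coef_b_eq0 : coef_b y k.+1 = 0 by apply: hb1; apply/coef_b_eq0; right.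
  by lra.
- by have := le0 _ kd x1; have := ge0 _ kd1 x2.
- have := le0 _ kd1 x1.
  have /coef_a_eq0 : coef_a y k = 0 by apply: ha; apply/coef_a_eq0; right.
  by lra.
Qed.

End Phi.

Section Fan.
Variables (R : realType) (d : nat).
Local Notation n := (3 * d - 1)%N.
Local Notation ray := (@pell_ray R d).
Implicit Types (w : 'rV[R]_d) (l : 'I_n -> R).

(** Extended by 0 outside 1, ..., d, so that the formulas for the coefficients need
no special case at the ends. *)
Definition coord w (k : nat) : R := \sum_(j < d | j.+1 == k) w 0 j.

Lemma coordE w (j : 'I_d) : coord w j.+1 = w 0 j.
Proof. by rewrite /coord (big_pred1 j). Qed.

Lemma coord_out w k : ~~ (1 <= k <= d)%N -> coord w k = 0.
Proof. by move=> kd; rewrite /coord big_pred0 // => j; have := ltn_ord j; lia. Qed.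

Lemma coordP w w' : (forall k, (1 <= k <= d)%N -> coord w k = coord w' k) -> w = w'.
Proof.
by move=> h; apply/rowP => j; rewrite -!coordE; apply: h; have := ltn_ord j; lia.
Qed.

Lemma coord_sum (I : finType) (P : pred I) (F : I -> 'rV[R]_d) (l : I -> R) k :
  coord (\sum_(i | P i) l i *: F i) k = \sum_(i | P i) l i * coord (F i) k.
Proof.
rewrite /coord; under eq_bigr do rewrite summxE; rewrite exchange_big.
by apply: eq_bigr => i _; rewrite mulr_sumr; apply: eq_bigr => j _; rewrite mxE.
Qed.

Lemma coord_basis m k : (1 <= k <= d)%N -> coord (basis_vector R d m) k = (m == k)%:R.
Proof.
move=> kd; have kd' : (k.-1 < d)%N by lia.
have -> : k = (Ordinal kd').+1 by rewrite /=; lia.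
by rewrite coordE mxE eq_sym.
Qed.

Lemma coordB w w' k : coord (w - w') k = coord w k - coord w' k.
Proof. by rewrite /coord -sumrB; apply: eq_bigr => j _; rewrite !mxE. Qed.

Lemma coordN w k : coord (- w) k = - coord w k.
Proof. by rewrite /coord -sumrN; apply: eq_bigr => j _; rewrite !mxE. Qed.

Lemma coord_ray (i : 'I_n) k : (1 <= k <= d)%N ->
  coord (ray i) k = (i.+1 == k)%:R - (i.+1 == d + k)%N%:R
    + ((k < d) && (i.+1 == 2 * d + k))%N%:R - ((1 < k) && (i.+1 == 2 * d + k.-1))%N%:R.
Proof.
move=> kd; rewrite /pell_ray; case: (codeP i) => m md.
- have -> : (m <= d)%N by lia.
  rewrite coord_basis //.
  have -> : (m == d + k)%N = false by lia.
  have -> : (m == 2 * d + k)%N = false by lia.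
  have -> : (m == 2 * d + k.-1)%N = false by lia.
  by rewrite ?andbF ?subr0 ?sub0r ?addr0.
- have -> : (d + m <= d)%N = false by lia.
  have -> : (d + m <= 2 * d)%N by lia.
  rewrite coordN coord_basis // addKn.
  have -> : (d + m == k)%N = false by lia.
  have -> : (d + m == d + k)%N = (m == k) by lia.
  have -> : (d + m == 2 * d + k)%N = false by lia.
  have -> : (1 < k)%N && (d + m == 2 * d + k.-1)%N = false by lia.
  by rewrite ?andbF ?subr0 ?sub0r ?addr0.
- have -> : (2 * d + m <= d)%N = false by lia.
  have -> : (2 * d + m <= 2 * d)%N = false by lia.
  rewrite coordB !coord_basis // addKn.
  have -> : (2 * d + m == k)%N = false by lia.
  have -> : (2 * d + m == d + k)%N = false by lia.
  have -> : (k < d)%N && (2 * d + m == 2 * d + k)%N = (m == k) by lia.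
  have -> : (1 < k)%N && (2 * d + m == 2 * d + k.-1)%N = (m.+1 == k) by lia.
  by rewrite ?andbF ?subr0 ?sub0r ?add0r.
Qed.

(** The value of l at the coordinate with code x, and 0 if there is none. *)
Definition code_val l (x : nat) : R := \sum_(i < n | i.+1 == x) l i.

Lemma code_valE l (i : 'I_n) : code_val l i.+1 = l i.
Proof. by rewrite /code_val (big_pred1 i). Qed.

Lemma code_val_ge0 l x : (forall i, 0 <= l i) -> 0 <= code_val l x.
Proof. by move=> l0; apply: sumr_ge0. Qed.

Lemma code_val_fun (F : nat -> R) x : (1 <= x <= n)%N -> code_val (fun i => F i.+1) x = F x.
Proof.
move=> xn; have xn' : (x.-1 < n)%N by lia.
have -> : x = (Ordinal xn').+1 by rewrite /=; lia.
by rewrite code_valE.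
Qed.

Definition val_a l k := if (1 <= k <= d)%N then code_val l k else 0.
Definition val_b l k := if (1 <= k <= d)%N then code_val l (d + k) else 0.
Definition val_c l k := if (1 <= k < d)%N then code_val l (2 * d + k) else 0.

Lemma coord_comb l k :
  coord (\sum_i l i *: ray i) k = val_a l k - val_b l k + val_c l k - val_c l k.-1.
Proof.
rewrite /val_a /val_b; case: (boolP (1 <= k <= d)%N) => kd; last first.
  rewrite coord_out // /val_c; have -> : (1 <= k < d)%N = false by lia.
  have -> : (1 <= k.-1 < d)%N = false by lia.
  by rewrite !subr0 addr0.
rewrite coord_sum; under eq_bigr do rewrite coord_ray // !mulrDr !mulrN.
rewrite !big_split !sumrN /=.
have E (P : pred 'I_n) : \sum_i l i * (P i)%:R = \sum_(i | P i) l i.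
  by rewrite [RHS]big_mkcond; apply: eq_bigr => i _; case: (P i); rewrite ?mulr1 ?mulr0.
rewrite !E /val_c; congr (_ - _ + _ - _).
- have -> : (1 <= k < d)%N = (k < d)%N by lia.
  by case: (k < d)%N => //=; rewrite big_pred0.
- have -> : (1 <= k.-1 < d)%N = (1 < k)%N by lia.
  by case: (1 < k)%N => //=; rewrite big_pred0.
Qed.

Definition code_coef (x : nat -> R) c :=
  if (c <= d)%N then coef_a x c
  else if (c <= 2 * d)%N then coef_b x (c - d) else coef_c x (c - 2 * d).

Definition ray_coef w (i : 'I_n) := code_coef (coord w) i.+1.

Lemma code_coefA x k : (1 <= k <= d)%N -> code_coef x k = coef_a x k.
Proof. by rewrite /code_coef => /andP [_ ->]. Qed.

Lemma code_coefB x k : (1 <= k <= d)%N -> code_coef x (d + k) = coef_b x k.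
Proof.
move=> kd; rewrite /code_coef addKn.
have -> : (d + k <= d)%N = false by lia.
by have -> : (d + k <= 2 * d)%N by lia.
Qed.

Lemma code_coefC x k : (1 <= k < d)%N -> code_coef x (2 * d + k) = coef_c x k.
Proof.
move=> kd; rewrite /code_coef addKn.
have -> : (2 * d + k <= d)%N = false by lia.
by have -> : (2 * d + k <= 2 * d)%N = false by lia.
Qed.

(** The order matters: the first rule of the list that matches the shape of
the code is the right one, since every code matches the rule for a_k. *)
Definition code_coefE := (code_coefC, code_coefB, code_coefA).

Lemma ray_coef_ge0 w i : 0 <= ray_coef w i.
Proof.
rewrite /ray_coef; case: (codeP i) => k kd; rewrite code_coefE //.
- exact: coef_a_ge0.
- by apply: coef_b_ge0; lia.
- exact: coef_c_ge0.
Qed.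

Lemma coord0 w : coord w 0 = 0. Proof. by rewrite coord_out. Qed.
Lemma coordS w : coord w d.+1 = 0. Proof. by rewrite coord_out //; lia. Qed.

Lemma coef_c_bound w k : ~~ (1 <= k < d)%N -> coef_c (coord w) k = 0.
Proof.
move=> kd; apply/coef_c_eq0.
have [k0|k0] := boolP (1 <= k <= d)%N; last by left; rewrite coord_out.
by right; rewrite coord_out //; lia.
Qed.

Lemma ray_coef_sum w : w = \sum_i ray_coef w i *: ray i.
Proof.
apply: coordP => k kd; rewrite coord_comb /val_a /val_b /val_c kd.
rewrite [LHS]coef_decomp; congr (_ - _ + _ - _).
- by rewrite code_val_fun ?code_coefE //; lia.
- by rewrite code_val_fun ?code_coefE //; lia.
- case: ifP => kd'; last by rewrite coef_c_bound // kd'.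
  by rewrite code_val_fun ?code_coefE //; lia.
- case: ifP => kd'; last by rewrite coef_c_bound // kd'.
  by rewrite code_val_fun ?code_coefE //; lia.
Qed.

Lemma ray_coef_clique w (i j : 'I_n) : incomp d i.+1 j.+1 -> ray_coef w i = 0 \/ ray_coef w j = 0.
Proof.
rewrite /ray_coef; case: (codeP i) => k kd; rewrite code_coefE //;
  [rewrite incomp_aE //|rewrite incomp_bE //|rewrite incomp_cE //].
- case/or3P => [/eqP ->|/andP [kd' /eqP ->]|/andP [k1 /eqP ->]]; rewrite code_coefE; try lia.
  + by case: k kd => // k _; apply: coef_ab_excl.
  + exact: coef_ab1_excl.
  + by case: k kd k1 => // k _ _; apply: coef_ac1_excl.
- case/or3P => [/eqP ->|/andP [k1 /eqP ->]|/andP [k1 /eqP ->]]; rewrite code_coefE; try lia.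
  + by case: k kd => // k _; apply/or_comm; apply: coef_ab_excl.
  + by case: k kd k1 => // k _ _; apply/or_comm; apply: coef_ab1_excl.
  + by case: k kd k1 => // k _ _; apply: coef_bc_excl.
- case/or4P => [/eqP ->|/eqP ->|/andP [k1 /eqP ->]|/andP [k1 /eqP ->]]; rewrite code_coefE; try lia.
  + by case: k kd => // k _; apply/or_comm; apply: coef_bc_excl.
  + by apply/or_comm; apply: coef_ac1_excl.
  + by case: k kd k1 => // k _ _; apply/or_comm; apply: coef_cc_excl.
  + exact: coef_cc_excl.
Qed.

Lemma code_val_clique l x y : (forall i j : 'I_n, incomp d i.+1 j.+1 -> l i = 0 \/ l j = 0) ->
  incomp d x y -> code_val l x = 0 \/ code_val l y = 0.
Proof.
move=> h xy.
have out z : ~~ (1 <= z <= n)%N -> code_val l z = 0.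
  by move=> zn; rewrite /code_val big_pred0 // => i; have := ltn_ord i; lia.
have [xn|/out] := boolP (1 <= x <= n)%N; last by left.
have [yn|/out] := boolP (1 <= y <= n)%N; last by right.
have xn' : (x.-1 < n)%N by lia. have yn' : (y.-1 < n)%N by lia.
have ex : x = (Ordinal xn').+1 by rewrite /=; lia.
have ey : y = (Ordinal yn').+1 by rewrite /=; lia.
by move: xy; rewrite ex ey !code_valE; apply: h.
Qed.

(** Uniqueness of the expression of a vector as a nonnegative combination of
compatible rays. *)
Lemma ray_coef_comb l : (forall i, 0 <= l i) ->
  (forall i j : 'I_n, incomp d i.+1 j.+1 -> l i = 0 \/ l j = 0) ->
  forall i, ray_coef (\sum_i l i *: ray i) i = l i.
Proof.
move=> l0 cl.
have a0 k : 0 <= val_a l k by rewrite /val_a; case: ifP => // _; apply: code_val_ge0.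
have b0 k : 0 <= val_b l k by rewrite /val_b; case: ifP => // _; apply: code_val_ge0.
have c0 k : 0 <= val_c l k by rewrite /val_c; case: ifP => // _; apply: code_val_ge0.
have ab k : val_a l k = 0 \/ val_b l k = 0.
  rewrite /val_a /val_b; case: ifP => kd; last by left.
  by apply: code_val_clique => //; rewrite incomp_aE // eqxx.
have ab1 k : val_a l k = 0 \/ val_b l k.+1 = 0.
  rewrite /val_a /val_b; case: ifP => kd; last by left. case: ifP => kd'; last by right.
  by apply: code_val_clique => //; rewrite incomp_aE //; lia.
have ac1 k : val_a l k = 0 \/ val_c l k.-1 = 0.
  rewrite /val_a /val_c; case: ifP => kd; last by left. case: ifP => kd'; last by right.
  by apply: code_val_clique => //; rewrite incomp_aE //; lia.
have bc k : val_b l k = 0 \/ val_c l k = 0.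
  rewrite /val_b /val_c; case: ifP => kd; last by left. case: ifP => kd'; last by right.
  by apply: code_val_clique => //; rewrite incomp_bE //; lia.
have cc k : val_c l k = 0 \/ val_c l k.-1 = 0.
  rewrite /val_c; case: ifP => kd; last by left. case: ifP => kd'; last by right.
  by apply: code_val_clique => //; rewrite incomp_cE //; lia.
have xE := coord_comb l.
move=> i; rewrite -[RHS]code_valE /ray_coef; case: (codeP i) => k kd; rewrite code_coefE //.
- by rewrite (coef_a_comb a0 b0 c0 xE ab ab1 ac1 bc cc) /val_a kd.
- by rewrite (coef_b_comb a0 b0 c0 xE ab ab1 ac1 bc cc) /val_b kd.
- by rewrite (coef_c_comb a0 b0 c0 xE ab ab1 ac1 bc cc) /val_c kd.
Qed.

Definition clique (S : {set 'I_n}) := forall i j, i \in S -> j \in S -> ~~ incomp d i.+1 j.+1.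

Definition active_rays w : {set 'I_n} := [set i | ray_coef w i != 0]%SET.

Lemma active_rays_clique w : clique (active_rays w).
Proof.
move=> i j; rewrite !inE => /eqP pi /eqP pj; apply/negP => /(ray_coef_clique w) [] //.
Qed.

Lemma sum_in (S : {set 'I_n}) l :
  \sum_(i in S) l i *: ray i = \sum_i (if i \in S then l i else 0) *: ray i.
Proof. by rewrite big_mkcond; apply: eq_bigr => i _; case: ifP; rewrite ?scale0r. Qed.

Lemma ray_coef_in (S : {set 'I_n}) l : clique S -> (forall i, 0 <= l i) ->
  forall i, ray_coef (\sum_(i in S) l i *: ray i) i = if i \in S then l i else 0.
Proof.
move=> cS l0 i; rewrite sum_in ray_coef_comb // {i} => [i|i j ij].
  by case: ifP.
have [iS|] := boolP (i \in S); last by left.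
have [jS|] := boolP (j \in S); last by right.
by have := cS i j iS jS; rewrite ij.
Qed.

(** Existence and uniqueness of the coefficients turn membership in a cone over a
clique into an inclusion of supports. *)
Lemma cone_active_rays (S : {set 'I_n}) w : clique S -> cone ray S w <-> active_rays w \subset S.
Proof.
move=> cS; split.
  case=> l l0 ->; apply/fintype.subsetP => i; rewrite inE ray_coef_in //.
  by case: (i \in S); rewrite ?eqxx.
move=> /fintype.subsetP zS; exists (ray_coef w); first exact: ray_coef_ge0.
rewrite {1}[w]ray_coef_sum sum_in; apply: eq_bigr => i _.
case: ifPn => // /(contra (zS i)); rewrite inE negbK => /eqP ->; by [].
Qed.

Lemma active_rays_sum (S : {set 'I_n}) : clique S -> active_rays (\sum_(i in S) 1 *: ray i) = S.
Proof.
move=> cS; apply/setP => i; rewrite inE ray_coef_in //.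
by case: (i \in S); rewrite ?eqxx ?oner_eq0.
Qed.

Lemma active_rays_ray i : active_rays (ray i) = [set i]%SET.
Proof.
have <- : \sum_(j in [set i]%SET) 1 *: ray j = ray i by rewrite big_set1 scale1r.
by apply: active_rays_sum => j k; rewrite !inE => /eqP -> /eqP ->; rewrite incomp_irr.
Qed.

Lemma zero_sub_active_rays w w' :
  zero_sub d (coord w) (coord w') <-> active_rays w' \subset active_rays w.
Proof.
split=> [h|/fintype.subsetP h].
  apply/fintype.subsetP => i; rewrite !inE; apply: contra => /eqP H; apply/eqP; move: H.
  rewrite /ray_coef; case: (codeP i) => k kd; rewrite !code_coefE //.
  - by have [] := h k kd.
  - by have [] := h k kd.
  - by have [|_ _] := h k; [lia|apply; lia].
have hc c : (1 <= c <= n)%N -> code_coef (coord w) c = 0 -> code_coef (coord w') c = 0.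
  move=> cn; have cn' : (c.-1 < n)%N by lia.
  have -> : c = (Ordinal cn').+1 by rewrite /=; lia.
  by have := h (Ordinal cn'); rewrite !inE /ray_coef => /contraNN H /eqP /negPn /H /negPn /eqP.
move=> k kd; split; last move=> kd'.
- by have := hc k; rewrite !code_coefE //; apply; lia.
- by have := hc (d + k)%N; rewrite !code_coefE //; apply; lia.
- by have := hc (2 * d + k)%N; rewrite !code_coefE //; try lia; apply; lia.
Qed.

End Fan.
Arguments active_rays_clique {R d} w.

(** * Newton polytopes of products and their normal cones *)

Section Newton.
Variables (R : realType) (d : nat).
Implicit Types (w : 'rV[R]_d) (f g : {mpoly R[d]}) (m : 'X_{1..d}).

Definition nonneg_coefs f := forall m, 0 <= f@_m.

Definition weight w m : R := dotp w (exponent_vector R m).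

Lemma weightD w m m' : weight w (m + m')%MM = weight w m + weight w m'.
Proof.
rewrite /weight /dotp -big_split; apply: eq_bigr => i _ /=.
by rewrite !mxE mnmDE natrD mulrDr.
Qed.

Lemma weight0 w : weight w 0%MM = 0.
Proof. by rewrite /weight /dotp big1 // => i _; rewrite mxE mnmE mulr0. Qed.

Lemma weightU w i : weight w U_(i)%MM = w 0 i.
Proof.
rewrite /weight /dotp (bigD1 i) //= mxE mnmE eqxx mulr1 big1 ?addr0 // => j ji.
by rewrite mxE mnmE eq_sym (negbTE ji) mulr0.
Qed.

Definition argmin f w m :=
  m \in msupp f /\ forall m', m' \in msupp f -> weight w m <= weight w m'.

Lemma argmin_ex f w : f != 0 -> exists m, argmin f w m.
Proof.
rewrite -msupp_eq0 /argmin; elim: (msupp f : seq _) => // m s IH _.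
have [->|s0] := eqVneq s [::].
  by exists m; rewrite mem_seq1 eqxx; split=> // m'; rewrite mem_seq1 => /eqP ->.
have [m0 [m0s m0P]] := IH s0; have [h|h] := leP (weight w m) (weight w m0).
  exists m; rewrite mem_head; split=> // m'; rewrite inE => /orP [/eqP -> //|/m0P].
  exact: le_trans.
exists m0; rewrite inE m0s orbT; split=> // m'; rewrite inE => /orP [/eqP ->|/m0P //].
exact: ltW.
Qed.

Lemma nonneg_coefsM f g : nonneg_coefs f -> nonneg_coefs g -> nonneg_coefs (f * g).
Proof. by move=> f0 g0 m; rewrite mcoeffM sumr_ge0 // => k _; rewrite mulr_ge0. Qed.

(** Products of nonnegative coefficients cannot cancel. *)
Lemma msuppM_nonneg f g m m' :
  nonneg_coefs f -> nonneg_coefs g -> m \in msupp f -> m' \in msupp g ->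
  (m + m')%MM \in msupp (f * g).
Proof.
move=> f0 g0; rewrite !mcoeff_msupp => fm gm; rewrite mcoeffM.
have h1 : (mdeg m < (mdeg (m + m')%MM).+1)%N by rewrite mdegD ltnS leq_addr.
have h2 : (mdeg m' < (mdeg (m + m')%MM).+1)%N by rewrite mdegD ltnS leq_addl.
rewrite (bigD1 (BMultinom h1, BMultinom h2)) //= gt_eqF //.
apply: ltr_pwDl; first by rewrite mulr_gt0 // lt0r ?fm ?gm /=.
by apply: sumr_ge0 => k _; rewrite mulr_ge0.
Qed.

(** The vertices of the face selected by w lie in the face selected by w'. *)
Definition argmin_sub f w w' := forall m, argmin f w m -> argmin f w' m.

(** The face of a Minkowski sum selected by w is the sum of the faces selected by w. *)
Lemma argminM f g w m : nonneg_coefs f -> nonneg_coefs g ->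
  argmin (f * g) w m <->
  exists m1 m2, [/\ argmin f w m1, argmin g w m2 & m = (m1 + m2)%MM].
Proof.
move=> f0 g0; split.
  case=> /msuppM_le /allpairsP [[m1 m2] /= [h1 h2 ->]] mP.
  exists m1, m2; split=> //; split=> // m' m'P.
    by have := mP _ (msuppM_nonneg f0 g0 m'P h2); rewrite !weightD lerD2r.
  by have := mP _ (msuppM_nonneg f0 g0 h1 m'P); rewrite !weightD lerD2l.
case=> m1 [m2 [[h1 m1P] [h2 m2P] ->]]; split; first exact: msuppM_nonneg.
by move=> _ /msuppM_le /allpairsP [[m3 m4] /= [h3 h4 ->]]; rewrite !weightD lerD ?m1P ?m2P.
Qed.

(** For the direct implication, add to a minimizing exponent of one factor a
minimizing exponent of the other one. *)
Lemma argmin_subM f g w w' : nonneg_coefs f -> nonneg_coefs g -> f != 0 -> g != 0 ->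
  argmin_sub (f * g) w w' <-> argmin_sub f w w' /\ argmin_sub g w w'.
Proof.
move=> f0 g0 fn gn; split; last first.
  case=> hf hg m /(argminM _ _ f0 g0) [m1 [m2 [h1 h2 ->]]].
  by apply/(argminM _ _ f0 g0); exists m1, m2; split=> //; [apply: hf|apply: hg].
move=> h; have [mf mfP] := argmin_ex w fn; have [mg mgP] := argmin_ex w gn.
split=> m mP.
  have [|_ hm] := h (m + mg)%MM; first by apply/(argminM _ _ f0 g0); exists m, mg.
  split; first by case: mP.
  move=> m' m'P; have := hm _ (msuppM_nonneg f0 g0 m'P mgP.1).
  by rewrite !weightD lerD2r.
have [|_ hm] := h (mf + m)%MM; first by apply/(argminM _ _ f0 g0); exists mf, m.
split; first by case: mP.
move=> m' m'P; have := hm _ (msuppM_nonneg f0 g0 mfP.1 m'P).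
by rewrite !weightD lerD2l.
Qed.

Lemma nonneg_coefs1 : nonneg_coefs 1.
Proof. by move=> m; rewrite mcoeff1 ler0n. Qed.

Lemma argmin_sub_prod (I : eqType) (s : seq I) (F : I -> {mpoly R[d]}) w w' :
  (forall i, i \in s -> nonneg_coefs (F i) /\ F i != 0) ->
  [/\ nonneg_coefs (\prod_(i <- s) F i), \prod_(i <- s) F i != 0 &
    argmin_sub (\prod_(i <- s) F i) w w' <-> forall i, i \in s -> argmin_sub (F i) w w'].
Proof.
elim: s => [|i s IH] h.
  rewrite big_nil; split; [exact: nonneg_coefs1|exact: oner_neq0|split=> // _ m].
  rewrite /argmin msupp1 => -[]; rewrite mem_seq1 => /eqP -> _; split=> // m'.
  by rewrite mem_seq1 => /eqP ->.
have [|h1 h2 h3] := IH; first by move=> j js; apply: h; rewrite inE js orbT.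
have [i1 i2] := h i (mem_head i s).
rewrite big_cons; split; [exact: nonneg_coefsM|exact: mulf_neq0|].
rewrite argmin_subM // h3; split.
  by case=> hi hs j; rewrite inE => /orP [/eqP ->|/hs].
by move=> hj; split=> [|j js]; apply: hj; rewrite inE ?eqxx ?js ?orbT.
Qed.

Lemma dotp_sum w (s : seq 'X_{1..d}) (l : 'X_{1..d} -> R) :
  dotp w (\sum_(m <- s) l m *: exponent_vector R m) = \sum_(m <- s) l m * weight w m.
Proof.
rewrite /dotp; under eq_bigr do rewrite summxE mulr_sumr; rewrite exchange_big.
apply: eq_bigr => m _; rewrite /weight /dotp mulr_sumr; apply: eq_bigr => i _.
by rewrite !mxE mulrCA.
Qed.

Lemma newton_vertex f m : m \in msupp f -> newton_polytope f (exponent_vector R m).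
Proof.
move=> mf; exists (fun m' => (m' == m)%:R); split=> [m'||].
- exact: ler0n.
- by rewrite (bigD1_seq m) //= eqxx big1 ?addr0 // => m' /negbTE ->.
- rewrite (bigD1_seq m) //= eqxx scale1r big1 ?addr0 // => m' /negbTE ->.
  by rewrite scale0r.
Qed.

Lemma newton_min f w m y : argmin f w m -> newton_polytope f y -> weight w m <= dotp w y.
Proof.
case=> _ mP [l [l0 l1 ->]]; rewrite dotp_sum -[leLHS]mul1r -l1 mulr_suml.
rewrite !big_seq; apply: ler_sum => m' m'f; apply: ler_wpM2l => //; exact: mP.
Qed.

(** A point of the face is a convex combination of exponents; since its weight is
minimal, only minimizing exponents have a nonzero coefficient. *)
Lemma newton_face f w w' : f != 0 ->
  (face (newton_polytope f) w `<=` face (newton_polytope f) w')%classic <-> argmin_sub f w w'.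
Proof.
move=> fn; split=> [h m mP|h x].
  have [|_ hm] := h (exponent_vector R m).
    by split=> [|y]; [apply: newton_vertex; case: mP|apply: newton_min].
  split=> [|m' m'f]; first by case: mP.
  exact: (hm _ (newton_vertex m'f)).
have [m0 m0P] := argmin_ex w fn; have m0P' := h _ m0P.
case=> Px hx; split=> // y /(newton_min m0P'); apply: le_trans.
have := hx _ (newton_vertex m0P.1).
case: Px => l [l0 l1 ->]; rewrite !dotp_sum -/(weight w m0).
have E v : weight v m0 = \sum_(m <- msupp f) l m * weight v m0 by rewrite -mulr_suml l1 mul1r.
rewrite [X in _ <= X -> _]E -subr_le0 -sumrB => le0.
have ge0 m : m \in msupp f -> 0 <= l m * weight w m - l m * weight w m0.
  by move=> mf; rewrite -mulrBr mulr_ge0 // subr_ge0; apply: m0P.2.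
have z m : m \in msupp f -> l m = 0 \/ weight w m = weight w m0.
  move=> mf; have : l m * weight w m - l m * weight w m0 <= 0.
    apply: le_trans le0; rewrite (bigD1_seq m) //= lerDl big_seq_cond.
    by apply: sumr_ge0 => m' /andP [/ge0].
  move=> le; have /eqP : l m * (weight w m - weight w m0) = 0.
    by apply/le_anti; rewrite mulrBr le ge0.
  by rewrite mulf_eq0 subr_eq0 => /orP [] /eqP; [left|right].
rewrite [leRHS]E !big_seq; apply: ler_sum => m mf.
case: (z m mf) => [->|e]; first by rewrite !mul0r.
apply: ler_wpM2l => //; apply: (h m _).2; last exact: m0P.1.
by split=> // m' m'f; rewrite e; apply: m0P.2.
Qed.

Definition monomial_sum (s : seq 'X_{1..d}) : {mpoly R[d]} := \sum_(m <- s) 'X_[m].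

Lemma monomial_sumE s m : (monomial_sum s)@_m = (count_mem m s)%:R.
Proof.
rewrite /monomial_sum raddf_sum /= -sum1_count natr_sum [RHS]big_mkcond.
by apply: eq_bigr => m' _; rewrite mcoeffX /=; case: eqP.
Qed.

Lemma monomial_sum_nonneg s : nonneg_coefs (monomial_sum s).
Proof. by move=> m; rewrite monomial_sumE ler0n. Qed.

Lemma msupp_monomial_sum s m : (m \in msupp (monomial_sum s)) = (m \in s).
Proof. by rewrite mcoeff_msupp monomial_sumE pnatr_eq0 -lt0n -has_count has_pred1. Qed.

Lemma monomial_sum_neq0 m s : monomial_sum (m :: s) != 0.
Proof.
apply/eqP => /(congr1 (mcoeff m)) /eqP.
by rewrite mcoeff0 mcoeff_eq0 msupp_monomial_sum mem_head.
Qed.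

Lemma argmin_sub_monomial_sum s w w' : argmin_sub (monomial_sum s) w w' <->
  all (fun m => all (fun m' => weight w m <= weight w m') s ==>
                all (fun m' => weight w' m <= weight w' m') s) s.
Proof.
rewrite /argmin_sub /argmin; split=> [h|/allP h m].
  apply/allP => m ms; apply/implyP => /allP hm; apply/allP => m' m's.
  have [|_] := h m; first by rewrite msupp_monomial_sum; split=> // m'' m''s; apply: hm; rewrite -msupp_monomial_sum.
  by apply; rewrite msupp_monomial_sum.
rewrite msupp_monomial_sum => -[ms hm]; split=> // m'; rewrite msupp_monomial_sum => m's.
have /implyP hh := h m ms; apply/(allP (hh _)) => //; apply/allP => m'' m''s.
by apply: hm; rewrite msupp_monomial_sum.
Qed.

Lemma mvarE k : (1 <= k <= d)%N -> exists2 i : 'I_d, k = i.+1 & mvar R d k = 'X_i.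
Proof.
move=> kd; have kd' : (k.-1 < d)%N by lia.
exists (Ordinal kd'); first by rewrite /=; lia.
by rewrite /mvar insubT.
Qed.

(** The two families of factors have coefficients 1, so both their supports and
the absence of cancellation are immediate. *)
Lemma pell_argmin w w' : pell_poly R d != 0 /\
  (argmin_sub (pell_poly R d) w w' <-> refines d (coord w) (coord w')).
Proof.
pose F k := 1 + mvar R d k; pose G k := 1 + mvar R d k + mvar R d k * mvar R d k.+1.
have FE k : (1 <= k <= d)%N -> exists2 i : 'I_d, k = i.+1 & F k = monomial_sum [:: 0%MM; U_(i)%MM].
  case/mvarE => i ki xi; exists i => //.
  by rewrite /F xi /monomial_sum !big_cons big_nil addr0 mpolyX0.
have GE k : (1 <= k < d)%N -> exists i j : 'I_d, [/\ k = i.+1, k.+1 = j.+1 &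
    G k = monomial_sum [:: 0%MM; U_(i)%MM; (U_(i) + U_(j))%MM]].
  move=> kd; have [|i ki xi] := @mvarE k; first lia.
  have [|j kj xj] := @mvarE k.+1; first lia.
  exists i, j; split=> //.
  by rewrite /G xi xj /monomial_sum !big_cons big_nil addr0 mpolyX0 mpolyXD addrA.
have FP k : k \in index_iota 1 d.+1 -> nonneg_coefs (F k) /\ F k != 0.
  rewrite mem_index_iota => /FE [i _ ->]; split; [exact: monomial_sum_nonneg|exact: monomial_sum_neq0].
have GP k : k \in index_iota 1 d -> nonneg_coefs (G k) /\ G k != 0.
  rewrite mem_index_iota => /GE [i [j [_ _ ->]]]; split; [exact: monomial_sum_nonneg|exact: monomial_sum_neq0].
have [F1 F2 F3] := argmin_sub_prod w w' FP.
have [G1 G2 G3] := argmin_sub_prod w w' GP.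
rewrite /pell_poly -/F; split; first exact: mulf_neq0.
rewrite argmin_subM // F3 G3.
have FS k : (1 <= k <= d)%N -> argmin_sub (F k) w w' <->
    (0 <= coord w k -> 0 <= coord w' k) /\ (coord w k <= 0 -> coord w' k <= 0).
  case/FE => i ki ->; rewrite ki !coordE.
  rewrite argmin_sub_monomial_sum /= !andbT !weight0 !weightU !lexx /= !andbT.
  by split=> [/andP [/implyP h1 /implyP h2] //|[h1 h2]]; apply/andP; split; apply/implyP.
have GS k : (1 <= k < d)%N -> argmin_sub (G k) w w' <->
    [/\ (0 <= coord w k -> 0 <= coord w k + coord w k.+1 ->
           0 <= coord w' k /\ 0 <= coord w' k + coord w' k.+1),
        (coord w k <= 0 -> 0 <= coord w k.+1 -> coord w' k <= 0 /\ 0 <= coord w' k.+1) &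
        (coord w k.+1 <= 0 -> coord w k + coord w k.+1 <= 0 ->
          coord w' k.+1 <= 0 /\ coord w' k + coord w' k.+1 <= 0)].
  case/GE => i [j [ki kj ->]]; rewrite kj ki !coordE.
  rewrite argmin_sub_monomial_sum /= !andbT !weightD !weight0 !weightU !lexx /= !andbT.
  rewrite !lerDl !gerDl ?andbT.
  split=> [/and3P [/implyP h1 /implyP h2 /implyP h3]|[h1 h2 h3]].
    split=> a b; [by apply/andP/h1/andP|by apply/andP/h2/andP|].
    by apply/andP; rewrite andbC; apply/h3/andP.
  apply/and3P; split; apply/implyP => /andP [a b]; apply/andP; [exact: h1|exact: h2|].
  by have [] := h3 b a.
split=> [[hF hG] k kd|h].
  have kF : k \in index_iota 1 d.+1 by rewrite mem_index_iota.
  have [h1 h2] := (FS k kd).1 (hF k kF).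
  split=> // kd'; have kd2 : (1 <= k < d)%N by lia.
  by apply/(GS k kd2); apply: hG; rewrite mem_index_iota.
split=> k; rewrite mem_index_iota => kd.
  by apply/(FS k kd); have [] := h k kd.
by apply/(GS k kd); have [|_ _] := h k; [lia|apply; lia].
Qed.

End Newton.

(** * The complex of the fan and the u-equations *)

Section PellComplex.
Variables (R : realType) (d : nat).
Local Notation n := (3 * d - 1)%N.
Local Notation ray := (@pell_ray R d).
Implicit Types (w : 'rV[R]_d) (S T : {set 'I_n}).

Lemma normal_cone_face w :
  normal_cone (@pellytope R d) (face (@pellytope R d) w) = cone ray (active_rays w).
Proof.
apply/seteqP; rewrite /normal_cone /subset /=; split=> w' /=;
  have [f0 H] := pell_argmin w w'; have x0 (v : 'rV[R]_d) := coord0 v; have xd (v : 'rV[R]_d) := coordS v.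
- move/(newton_face _ _ f0)/H/(refines_zero_sub (x0 w) (xd w) (x0 w') (xd w'))/zero_sub_active_rays.
  by move=> h; apply/cone_active_rays => //; apply: active_rays_clique.
- move/(cone_active_rays _ (@active_rays_clique _ _ w))/zero_sub_active_rays.
  by move/(refines_zero_sub (x0 w) (xd w) (x0 w') (xd w'))/H/(newton_face _ _ f0).
Qed.

Lemma clique_sub S T : T \subset S -> clique S -> clique T.
Proof. by move=> /fintype.subsetP TS cS i j /TS iS /TS jS; apply: cS. Qed.

(** For a clique S, the sum of its rays selects a face with normal cone Cone(S).
Conversely, if Cone(S) is a normal cone, it is the cone over the clique T of
active rays of some w. Each ray of S has only itself as active ray, so it
belongs to T. *)
Lemma pell_complexE S : (S \in pell_complex R d) <-> clique S.
Proof.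
rewrite inE asboolE; split; last first.
  move=> cS; pose w := \sum_(i in S) 1 *: ray i.
  exists (face (@pellytope R d) w); first by exists w.
  by rewrite normal_cone_face active_rays_sum.
case=> F [w ->]; rewrite normal_cone_face => E.
apply: (clique_sub _ (active_rays_clique w)); apply/fintype.subsetP => i iS.
have : cone ray S (ray i).
  exists (fun j => (j == i)%:R) => [j|]; first exact: ler0n.
  rewrite (bigD1 i) //= eqxx scale1r big1 ?addr0 // => j /andP [_ /negbTE ->].
  by rewrite scale0r.
rewrite E => /(cone_active_rays _ (@active_rays_clique _ _ w)); rewrite active_rays_ray => /fintype.subsetP; apply.
by rewrite inE.
Qed.

Lemma clique2 (i j : 'I_n) : clique [set i; j]%SET <-> ~~ incomp d i.+1 j.+1.
Proof.
split=> [|h x y]; first by apply; rewrite !inE eqxx ?orbT.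
by rewrite !inE => /orP [] /eqP -> /orP [] /eqP ->; rewrite ?incomp_irr // incomp_sym.
Qed.

Lemma incompatibleE (i j : 'I_n) : incompatible (pell_complex R d) i j = incomp d i.+1 j.+1.
Proof.
rewrite /incompatible; apply/idP/idP => [h|h].
  by apply: contraNT h => h; apply/pell_complexE/clique2.
by apply/negP => /pell_complexE/clique2; rewrite h.
Qed.

Lemma pell_flag : is_flag_complex (pell_complex R d).
Proof.
split; first split.
- apply/set0Pn; exists finset.set0; apply/pell_complexE => i j; by rewrite inE.
- by move=> S T /pell_complexE cS TS; apply/pell_complexE; apply: clique_sub TS cS.
- by move=> k; apply/pell_complexE => i j; rewrite !inE => /eqP -> /eqP ->; rewrite incomp_irr.
move=> S h; apply/pell_complexE => i j iS jS.
have [->|ij] := eqVneq i j; first by rewrite incomp_irr.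
by have /pell_complexE/clique2 := h i j iS jS ij.
Qed.

Lemma code_coef_perturb (x y : nat -> R) c : (1 <= c)%N -> 1 <= code_coef d x c ->
  (forall k, `|y k - x k| <= 4^-1) -> code_coef d y c != 0.
Proof.
move=> c1 + h; have {}h k : y k - x k <= 4^-1 /\ x k - y k <= 4^-1.
  by have := h k; rewrite ler_norml => /andP [h1 h2]; split=> //; rewrite lerNl opprB in h1.
rewrite /code_coef; case: ifP => c2; [|case: ifP => c3].
- move=> /coef_a_ge1 [e1 e2]; apply/eqP => /coef_a_eq0; have [h1 h2] := h c; have [h3 h4] := h c.+1.
  by case=> ?; lra.
- have : (1 <= c - d)%N by lia.
  case: (c - d)%N => // k _ /coef_b_ge1 [e1 e2]; apply/eqP => /coef_b_eq0.
  have [h1 h2] := h k; have [h3 h4] := h k.+1.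
  by case=> ?; lra.
- move=> /coef_c_ge1 [e1 e2]; apply/eqP => /coef_c_eq0.
  have [h1 h2] := h (c - 2 * d)%N; have [h3 h4] := h (c - 2 * d).+1.
  by case=> ?; lra.
Qed.

(** The fan is complete: from the sum x of the rays of S, move slightly in a
direction outside their span. The rays of S remain active, and some other ray
becomes active. The active rays of a vector form a clique. *)
Lemma clique_extend S : clique S -> (#|S| < d)%N -> exists2 i, i \notin S & clique (i |: S)%SET.
Proof.
move=> cS Sd; pose W := (\sum_(i in S) <<ray i>>)%MS.
have [k kW] : exists k : 'I_d, ~~ ((delta_mx 0 k : 'rV[R]_d) <= W)%MS.
  apply: contrapT => /forallNP h.
  have : ((1%:M : 'M[R]_d) <= W)%MS.
    by apply/row_subP => k; rewrite row1; apply/negPn/negP/h.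
  move/mxrankS; rewrite mxrank1 leqNgt => /negP; apply.
  apply: leq_ltn_trans Sd; rewrite -sum1_card.
  rewrite /W; elim/big_rec2: _ => [|i r A _ rA]; first by rewrite mxrank0.
  apply: leq_trans (mxrank_adds_leqif _ _).1 _.
  by apply: leq_add rA; rewrite mxrank_gen rank_leq_row.
pose x := \sum_(i in S) 1 *: ray i.
have xE := active_rays_sum R cS; rewrite -/x in xE.
(* The coefficients of x on S are 1, and a quarter is within the margin of
   code_coef_perturb. *)
pose y := x + 4^-1 *: delta_mx 0 k.
have Sy : S \subset active_rays y.
  apply/fintype.subsetP => i iS; rewrite inE; apply: (@code_coef_perturb (coord x)) => //.
    by rewrite -/(ray_coef x i) ray_coef_in ?iS.
  move=> j; rewrite -coordB /y addrC addKr.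
  have [jd|jd] := boolP (1 <= j <= d)%N; last by rewrite coord_out // normr0 invr_ge0 ler0n.
  have jd' : (j.-1 < d)%N by lia.
  have -> : j = (Ordinal jd').+1 by rewrite /=; lia.
  rewrite coordE !mxE eqxx /=; case: (_ == k); rewrite ?mulr1 ?mulr0 ?normr0 ?invr_ge0 ?ler0n //.
  by rewrite ger0_norm ?invr_ge0 ?ler0n.
have /fintype.subsetPn [i iy iS] : ~~ (active_rays y \subset S).
  apply: contra kW => yS; have : cone ray S y by apply/cone_active_rays.
  case=> l _ yE.
  have -> : delta_mx 0 k = \sum_(i in S) (4 * (l i - 1)) *: ray i :> 'rV[R]_d.
    transitivity (4 *: (y - x)); first by rewrite /y addrC addKr scalerA divff ?scale1r ?pnatr_eq0.
    by rewrite yE -sumrB scaler_sumr; apply: eq_bigr => i _; rewrite -scalerBl scalerA.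
  by apply: summx_sub_sums => i iS; rewrite scalemx_sub // genmxE.
exists i => //; apply: (clique_sub _ (active_rays_clique y)).
by rewrite finset.subUset finset.sub1set Sy andbT.
Qed.

Lemma clique_facet S : clique S -> exists T, [/\ S \subset T, clique T & (d <= #|T|)%N].
Proof.
move: {2}(d - #|S|)%N (leqnn (d - #|S|)) => m; elim: m S => [|m IH] S Sm cS.
  by exists S; split=> //; lia.
have [dS|Sd] := leqP d #|S|; first by exists S.
have [i iS ciS] := clique_extend cS Sd.
have [||T [ST cT dT]] := IH (i |: S)%SET; [by rewrite cardsU1 iS; lia|by []|].
by exists T; split=> //; apply: fintype.subset_trans ST; apply: finset.subsetUr.
Qed.

Lemma prod_neighbours (K : comNzRingType) (s : seq nat) :
  uniq s -> all (fun x => 1 <= x <= n)%N s ->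
  \prod_(j < n | j.+1 \in s) ('X_j : {mpoly K[n]}) = \prod_(x <- s) mvar K n x.
Proof.
elim: s => [|x s IH] /=; first by rewrite big_nil big_pred0.
case/andP => xs us /andP [xn sn]; rewrite big_cons -IH //.
have xn' : (x.-1 < n)%N by lia.
rewrite (bigD1 (Ordinal xn')) /=; last by rewrite prednK ?mem_head //; lia.
rewrite /mvar insubT; congr (_ * _); apply: eq_bigl => j; rewrite inE.
have -> : (j == Ordinal xn') = (j.+1 == x) by rewrite -val_eqE /=; lia.
by case: eqP => [->|_]; rewrite /= ?andbT ?(negbTE xs).
Qed.

Lemma pell_u_equation i : is_u_equation (pell_complex R d) i (@pell_equation R d i).
Proof.
exists (fun=> 1%N); split=> //.
rewrite (eq_bigl (fun j : 'I_n => j.+1 \in nbrs d i.+1)); last exact: incompatibleE.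
under eq_bigr do rewrite expr1.
have mi : 'X_i = mvar R[i] n i.+1 by rewrite /mvar /= valK.
rewrite mi prod_neighbours; [|exact: nbrs_uniq|exact: nbrs_code].
rewrite /pell_equation; case: (codeP i) => k kd.
- have -> : (k <= d)%N by lia.
  rewrite nbrs_aE // !big_cat big_seq1 /= /pell_a /pell_b /pell_c.
  have -> : (k == 0)%N = false by lia.
  have -> : (k == d.+1)%N = false by lia.
  have -> : (k.+1 == d.+1)%N = ~~ (k < d)%N by lia.
  have -> : (k.-1 == 0)%N || (k.-1 == d)%N = ~~ (1 < k)%N by lia.
  by case: (k < d)%N; case: (1 < k)%N; rewrite ?big_seq1 ?big_nil /= ?mulr1 ?mul1r ?mulrA.
- have -> : (d + k <= d)%N = false by lia.
  have -> : (d + k <= 2 * d)%N by lia.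
  rewrite addKn nbrs_bE // !big_cat big_seq1 /= /pell_a /pell_b /pell_c.
  have -> : (k == 0)%N = false by lia.
  have -> : (k == d.+1)%N = false by lia.
  have -> : (k.-1 == 0)%N = ~~ (1 < k)%N by lia.
  have -> : false || (k == d)%N = ~~ (k < d)%N by lia.
  by case: (k < d)%N; case: (1 < k)%N; rewrite ?big_seq1 ?big_nil /= ?mulr1 ?mul1r ?mulrA.
- have -> : (2 * d + k <= d)%N = false by lia.
  have -> : (2 * d + k <= 2 * d)%N = false by lia.
  rewrite addKn nbrs_cE // !big_cat !big_cons big_nil ?mulr1 /= /pell_a /pell_b /pell_c.
  have -> : (k == 0)%N = false by lia.
  have -> : (k == d)%N = false by lia.
  have -> : (k == d.+1)%N = false by lia.
  have -> : (k.-1 == 0)%N || (k.-1 == d)%N = ~~ (1 < k)%N by lia.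
  have -> : (k.+1 == d)%N = ~~ (k.+1 < d)%N by lia.
  by case: (k.+1 < d)%N; case: (1 < k)%N; rewrite ?big_seq1 ?big_nil /= ?mulr1 ?mul1r ?mulrA.
Qed.
End PellComplex.

(** * The Pellspace as a chain of links *)

Section Linked.
Variable K : fieldType.
Implicit Types p q a b c : K.

(** One link of the chain, for p = p_k, p' = p_(k+1), a = a_k, b = b_(k+1) and c = c_k.
As 1 - p = b_k c_(k-1) and p' = a_(k+1) c_(k+1), the first and the last two
equations are the u-equations of c_k, a_k and b_(k+1). *)
Definition linked p p' a b c :=
  [/\ c = 1 - (1 - p) * p', a * c = p, b * c = 1 - p', a + (1 - p) * b = 1 & b + a * p' = 1].

Lemma linked_div p p' : 1 - (1 - p) * p' != 0 ->
  linked p p' (p / (1 - (1 - p) * p')) ((1 - p') / (1 - (1 - p) * p')) (1 - (1 - p) * p').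
Proof.
by move=> c0; split=> //; field.
Qed.

Lemma linked0 a b : a + b = 1 -> linked 0 1 a b 0.
Proof. by move=> ab; split; rewrite ?mulr0 ?mulr1 ?subr0 ?subrr ?mul1r // addrC. Qed.

Lemma linked_c0 p p' a b c : linked p p' a b c -> c = 0 -> [/\ p = 0, p' = 1 & a + b = 1].
Proof.
case=> _ ac bc h1 h2 c0; rewrite c0 mulr0 in ac; rewrite c0 mulr0 in bc.
have p'1 : p' = 1 by apply/esym/eqP; rewrite -subr_eq0 -bc.
by split=> //; rewrite -[RHS]h1 -ac subr0 mul1r.
Qed.

(** A curve of links with a fixed and c = t. It leaves the locus c = 0, and b stays 0
if it is 0 at t = 0, since then a = 1. *)
Lemma linked_near a t : 1 - a * t != 0 ->
  linked (a * t) ((1 - t) / (1 - a * t)) a ((1 - a) / (1 - a * t)) t.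
Proof. by move=> h; split; field. Qed.
End Linked.

Section Space.
Variables (R : realType) (d : nat).
Hypothesis hd : (1 <= d)%N.
Local Notation K := R[i].
Local Notation n := (3 * d - 1)%N.
Implicit Types (u v : 'rV[K]_n) (k : nat) (S T : {set 'I_n}).

Lemma ord_code k : (1 <= k <= n)%N -> exists i : 'I_n, i.+1 = k.
Proof. by move=> kn; have kn' : (k.-1 < n)%N by [lia]; exists (Ordinal kn'); rewrite /=; lia. Qed.

(** The coordinates of u with their boundary conventions: u_a is 1 at 0, u_b is 1 at
d + 1 and u_c is 1 at 0 and at d. *)
Definition u_a u k : K := (@pell_a R d k).@[u 0].
Definition u_b u k : K := (@pell_b R d k).@[u 0].
Definition u_c u k : K := (@pell_c R d k).@[u 0].

Lemma meval_mvar u (i : 'I_n) : (mvar K n i.+1).@[u 0] = u 0 i.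
Proof. by rewrite /mvar /= valK mevalXU. Qed.

Lemma u_a_code u (i : 'I_n) k : i.+1 = k -> u_a u k = u 0 i.
Proof. by move=> <-; rewrite /u_a /pell_a meval_mvar. Qed.

Lemma u_b_code u (i : 'I_n) k : (k <= d)%N -> i.+1 = (d + k)%N -> u_b u k = u 0 i.
Proof.
move=> kd e; rewrite /u_b /pell_b; have -> : (k == d.+1) = false by lia.
by rewrite -e meval_mvar.
Qed.

Lemma u_c_code u (i : 'I_n) k : (1 <= k < d)%N -> i.+1 = (2 * d + k)%N -> u_c u k = u 0 i.
Proof.
move=> kd e; rewrite /u_c /pell_c; have -> : (k == 0)%N || (k == d) = false by lia.
by rewrite -e meval_mvar.
Qed.

Lemma u_a0 u : u_a u 0 = 1. Proof. by rewrite /u_a /pell_a meval1. Qed.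
Lemma u_bS u : u_b u d.+1 = 1. Proof. by rewrite /u_b /pell_b eqxx meval1. Qed.
Lemma u_c0 u : u_c u 0 = 1. Proof. by rewrite /u_c /pell_c meval1. Qed.
Lemma u_cd u : u_c u d = 1. Proof. by rewrite /u_c /pell_c eqxx orbT meval1. Qed.

Lemma pellspaceE u : pellspace R d u <->
  (forall k, (1 <= k <= d)%N -> u_a u k + u_b u k * u_b u k.+1 * u_c u k.-1 = 1 /\
     u_b u k + u_a u k.-1 * u_a u k * u_c u k = 1) /\
  (forall k, (1 <= k < d)%N -> u_c u k + u_b u k * u_a u k.+1 * u_c u k.-1 * u_c u k.+1 = 1).
Proof.
have E (i : 'I_n) k : i.+1 = k -> (@pell_equation R d i).@[u 0] =
   if (k <= d)%N then u_a u k + u_b u k * u_b u k.+1 * u_c u k.-1 - 1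
   else if (k <= 2 * d)%N then
     u_b u (k - d) + u_a u (k - d).-1 * u_a u (k - d) * u_c u (k - d) - 1
      else u_c u (k - 2 * d) +
     u_b u (k - 2 * d) * u_a u (k - 2 * d).+1 * u_c u (k - 2 * d).-1 * u_c u (k - 2 * d).+1 - 1.
  move=> <-.
  rewrite /pell_equation /=; case: ifP => _; [|case: ifP => _];
    by rewrite mevalB mevalD !mevalM meval1.
split=> [h|[h1 h2] _ [i _ <-]]; last first.
  rewrite (E i _ erefl); case: (codeP i) => k kd.
  - have -> : (k <= d)%N by lia.
    by apply/eqP; rewrite subr_eq0; apply/eqP; have [] := h1 k kd.
  - have -> : (d + k <= d)%N = false by lia.
    have -> : (d + k <= 2 * d)%N by lia.
    by rewrite addKn; apply/eqP; rewrite subr_eq0; apply/eqP; have [] := h1 k kd.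
  - have -> : (2 * d + k <= d)%N = false by lia.
    have -> : (2 * d + k <= 2 * d)%N = false by lia.
    by rewrite addKn; apply/eqP; rewrite subr_eq0; apply/eqP; apply: h2.
have {}h i : (@pell_equation R d i).@[u 0] = 0 by apply: h; exists i.
split=> [k kd|k kd].
  split; apply/eqP; rewrite -subr_eq0; apply/eqP.
    have [|i ik] := @ord_code k; first lia.
    rewrite -[RHS](h i) (E _ _ ik); by have -> : (k <= d)%N by lia.
  have [|i ik] := @ord_code (d + k)%N; first lia.
  rewrite -[RHS](h i) (E _ _ ik) addKn; have -> : (d + k <= d)%N = false by lia.
  by have -> : (d + k <= 2 * d)%N by lia.
apply/eqP; rewrite -subr_eq0; apply/eqP.
have [|i ik] := @ord_code (2 * d + k)%N; first lia.
rewrite -[RHS](h i) (E _ _ ik) addKn; have -> : (2 * d + k <= d)%N = false by lia.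
by have -> : (2 * d + k <= 2 * d)%N = false by lia.
Qed.

(** The value 0 at d + 1 makes the last link, where c_d = 1 and b_(d+1) = 1, an instance
of the general one. *)
Definition u_p u k : K := if (k <= d)%N then u_a u k * u_c u k else 0.

(** The u-equations of a_k, b_(k+1) and c_k imply a_k c_k + b_k c_(k-1) = 1. With q the
product b_k c_(k-1) and r = a_(k+1) c_(k+1), they read a_k = 1 - q b_(k+1),
b_(k+1) = 1 - a_k r and c_k = 1 - q r, so a_k c_k = a_k - q (1 - b_(k+1)) = 1 - q.
The links follow by substitution, and the converse is similar. *)
Lemma pellspace_links u : pellspace R d u <->
  forall k, (k <= d)%N -> linked (u_p u k) (u_p u k.+1) (u_a u k) (u_b u k.+1) (u_c u k).
Proof.
rewrite pellspaceE; split.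
  case=> h1 h2.
  have q k : (1 <= k <= d)%N -> u_b u k * u_c u k.-1 = 1 - u_p u k.
    move=> kd; have -> : u_p u k = u_a u k * u_c u k by rewrite /u_p; have -> : (k <= d)%N by lia.
    have [e1 _] := h1 k kd.
    have [kd'|kd'] := ltnP k d; last first.
      have ek : k = d by lia.
      by rewrite -[X in X - _]e1 ek u_bS u_cd; ring.
    have kd1 : (1 <= k.+1 <= d)%N by lia.
    have [_ /= e2] := h1 _ kd1.
    have kd2 : (1 <= k < d)%N by lia.
    have e3 := h2 _ kd2.
    move: e1 e2 e3; set a := u_a u k; set b := u_b u k; set b' := u_b u k.+1; set c := u_c u k.
    set a' := u_a u k.+1; set c' := u_c u k.+1; set c0 := u_c u k.-1 => e1 e2 e3.
    have aE : a = 1 - b * b' * c0 by rewrite -e1; ring.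
    have cE : c = 1 - b * a' * c0 * c' by rewrite -e3; ring.
    have e4 : a * a' * c' = 1 - b' by rewrite -e2; ring.
    transitivity (1 - a + b * c0 * (a * a' * c')); last by rewrite cE; ring.
    by rewrite e4 aE; ring.
  have PE k : (k <= d)%N -> u_p u k = u_a u k * u_c u k by rewrite /u_p => ->.
  have u_p0 : u_p u 0 = 1 by rewrite PE // u_a0 u_c0 mulr1.
  have Pd : u_p u d.+1 = 0 by rewrite /u_p ltnn.
  move=> k kd.
  have bc : u_b u k.+1 * u_c u k = 1 - u_p u k.+1.
    have [kd'|kd'] := ltnP k d; first by apply: (q k.+1); lia.
    have -> : k = d by lia.
    by rewrite Pd u_bS u_cd subr0 mulr1.
  have e1 : u_a u k + (1 - u_p u k) * u_b u k.+1 = 1.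
    have [->|k0] := eqVneq k 0%N; first by rewrite u_p0 u_a0 subrr mul0r addr0.
    have kd1 : (1 <= k <= d)%N by lia.
    by rewrite -q // -[RHS](h1 k kd1).1; ring.
  have e2 : u_b u k.+1 + u_a u k * u_p u k.+1 = 1.
    have [kd'|kd'] := ltnP k d; last first.
      by have -> : k = d by [lia]; rewrite Pd u_bS mulr0 addr0.
    have kd1 : (1 <= k.+1 <= d)%N by lia.
    by rewrite PE // -[RHS](h1 _ kd1).2 /=; ring.
  split=> //; last by rewrite PE.
  have [->|k0] := eqVneq k 0%N; first by rewrite u_p0 u_c0; ring.
  have [kd'|kd'] := ltnP k d; last first.
    by have -> : k = d by [lia]; rewrite Pd u_cd; ring.
  have kd1 : (1 <= k <= d)%N by lia. have kd2 : (1 <= k < d)%N by lia.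
  rewrite -q // (PE k.+1) //.
  by rewrite -(h2 k kd2); ring.
move=> L; split=> k kd.
  have [|_ _ _ e1 e2] := L k; first lia.
  have [|_ _ e3 _ e4] := L k.-1; first lia.
  have kk : k.-1.+1 = k by lia.
  rewrite kk in e3 e4; split.
    by rewrite -[RHS]e1 -e3; ring.
  by rewrite -[RHS]e4 /u_p; have -> : (k <= d)%N by [lia]; ring.
have [|e1 _ _ _ _] := L k; first lia.
have [|_ _ e3 _ _] := L k.-1; first lia.
have kk : k.-1.+1 = k by lia.
rewrite kk in e3; rewrite [X in X + _]e1 -e3 /u_p; have -> : (k < d)%N by lia.
by ring.
Qed.

Definition point_of (fa fb fc : nat -> K) : 'rV[K]_n :=
  \row_(i < n) (if (i.+1 <= d)%N then fa i.+1 else if (i.+1 <= 2 * d)%N then fb (i.+1 - d)%N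
                else fc (i.+1 - 2 * d)%N).

Lemma u_a_point fa fb fc k : fa 0%N = 1 -> (k <= d)%N -> u_a (point_of fa fb fc) k = fa k.
Proof.
move=> fa0 kd; have [->|k0] := eqVneq k 0%N; first by rewrite u_a0.
have [|i ik] := @ord_code k; first lia.
by rewrite (u_a_code _ ik) mxE ik kd.
Qed.

Lemma u_b_point fa fb fc k : fb d.+1 = 1 -> (1 <= k <= d.+1)%N -> u_b (point_of fa fb fc) k = fb k.
Proof.
move=> fb0 kd; have [->|k0] := eqVneq k d.+1; first by rewrite u_bS.
have [|i ik] := @ord_code (d + k)%N; first lia.
have kd' : (k <= d)%N by lia.
rewrite (u_b_code _ kd' ik) mxE ik addKn.
have -> : (d + k <= d)%N = false by lia.
by have -> : (d + k <= 2 * d)%N by lia.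
Qed.

Lemma u_c_point fa fb fc k :
  fc 0%N = 1 -> fc d = 1 -> (k <= d)%N -> u_c (point_of fa fb fc) k = fc k.
Proof.
move=> fc0 fcd kd; have [->|k0] := eqVneq k 0%N; first by rewrite u_c0.
have [->|k1] := eqVneq k d; first by rewrite u_cd.
have [|i ik] := @ord_code (2 * d + k)%N; first lia.
have kd' : (1 <= k < d)%N by lia.
rewrite (u_c_code _ kd' ik) mxE ik addKn.
have -> : (2 * d + k <= d)%N = false by lia.
by have -> : (2 * d + k <= 2 * d)%N = false by lia.
Qed.

Section Glue.
Variables (ex : nat -> bool) (p a b : nat -> K).

(** A point is rebuilt from the p_k, and from a_k and b_(k+1) for the links k of the
set ex only; the other links have c_k nonzero and are determined by
p_k and p_(k+1). *)
Definition glue_c k := 1 - (1 - p k) * p k.+1.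
Definition glue_a k := if ex k then a k else p k / glue_c k.
Definition glue_b k := if ex k.-1 then b k else (1 - p k) / glue_c k.-1.
Definition glue := point_of glue_a glue_b glue_c.

Hypothesis p0 : p 0%N = 1.
Hypothesis pd : p d.+1 = 0.
Hypothesis exr : forall k, ex k -> (1 <= k < d)%N.

Let ex0 : ex 0%N = false. Proof. by apply/negP => /exr. Qed.
Let exd : ex d = false. Proof. by apply/negP => /exr; lia. Qed.

Lemma u_c_glue k : (k <= d)%N -> u_c glue k = glue_c k.
Proof.
move=> kd; apply: u_c_point => //; first by rewrite /glue_c p0 subrr mul0r subr0.
by rewrite /glue_c pd mulr0 subr0.
Qed.

Lemma u_a_glue k : (k <= d)%N -> u_a glue k = glue_a k.
Proof. by move=> kd; apply: u_a_point => //; rewrite /glue_a ex0 /glue_c p0 subrr mul0r subr0 divr1. Qed.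

Lemma u_b_glue k : (1 <= k <= d.+1)%N -> u_b glue k = glue_b k.
Proof. by move=> kd; apply: u_b_point => //; rewrite /glue_b /= exd /glue_c pd mulr0 !subr0 divr1. Qed.

Lemma glue_links :
  (forall k, ex k -> linked (p k) (p k.+1) (a k) (b k.+1) (glue_c k)) ->
  (forall k, (k <= d)%N -> ~~ ex k -> glue_c k != 0) ->
  pellspace R d glue.
Proof.
move=> Lex Lne.
have L k : (k <= d)%N -> linked (p k) (p k.+1) (glue_a k) (glue_b k.+1) (glue_c k).
  move=> kd; rewrite /glue_a /glue_b /=; case: ifPn => ek; first exact: Lex.
  by apply: linked_div; apply: Lne.
have PE k : (k <= d.+1)%N -> u_p glue k = p k.
  rewrite /u_p leq_eqVlt => /orP [/eqP ->|kd]; first by rewrite ltnn pd.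
  rewrite ltnS in kd; rewrite kd u_a_glue // u_c_glue //; by have [] := L k kd.
apply/pellspace_links => k kd.
by rewrite !PE ?u_a_glue ?u_b_glue ?u_c_glue //; [apply: L|lia].
Qed.

End Glue.

Lemma point_eq u v : (forall k, (1 <= k <= d)%N -> u_a u k = u_a v k) ->
  (forall k, (1 <= k <= d)%N -> u_b u k = u_b v k) ->
  (forall k, (1 <= k < d)%N -> u_c u k = u_c v k) -> u = v.
Proof.
move=> hA hB hC; apply/rowP => i; have [j ij] : exists j : 'I_n, j = i by exists i.
move: (erefl i.+1); rewrite -{2}ij; case: (codeP j) => k kd ik.
- by rewrite -!(u_a_code _ ik); apply: hA.
- by have kd' : (k <= d)%N by [lia]; rewrite -!(u_b_code _ kd' ik); apply: hB.
- by rewrite -!(u_c_code _ kd ik); apply: hC.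
Qed.

Lemma u_p0 u : u_p u 0 = 1. Proof. by rewrite /u_p u_a0 u_c0 mulr1. Qed.
Lemma u_pS u : u_p u d.+1 = 0. Proof. by rewrite /u_p ltnn. Qed.

Lemma glueK u (ex : nat -> bool) : pellspace R d u ->
  (forall k, ex k -> (1 <= k < d)%N) -> (forall k, (k <= d)%N -> ~~ ex k -> u_c u k != 0) ->
  glue ex (u_p u) (u_a u) (u_b u) = u.
Proof.
move=> /pellspace_links L exr Lne.
have cE k : (k <= d)%N -> glue_c (u_p u) k = u_c u k by move=> kd; have [] := L k kd.
apply: point_eq => k kd.
- rewrite u_a_glue ?u_p0 ?u_pS //; last lia.
  rewrite /glue_a cE; last lia.
  case: ifPn => // ek; have [|_ <- _ _ _] := L k; first lia.
  by rewrite mulfK // Lne //; lia.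
- rewrite u_b_glue ?u_p0 ?u_pS //; last lia.
  rewrite /glue_b cE; last lia.
  case: ifPn => // ek; have [|_ _ + _ _] := L k.-1; first lia.
  have -> : k.-1.+1 = k by lia.
  by move=> <-; rewrite mulfK // Lne //; lia.
- rewrite u_c_glue ?u_p0 ?u_pS //; last lia.
  by rewrite cE //; lia.
Qed.

(** A family of points built by [glue] is a rational curve, regular at t0 as soon
as its ingredients are, if the divisors c_k are nonzero at t0. *)
Lemma glue_regular t0 (ex : nat -> bool) (p a b : K -> nat -> K) :
  (forall k, regular_at t0 (fun t => p t k)) ->
  (forall k, regular_at t0 (fun t => a t k)) ->
  (forall k, regular_at t0 (fun t => b t k)) ->
  (forall k, (k <= d)%N -> ~~ ex k -> glue_c (p t0) k != 0) ->
  forall i, regular_at t0 (fun t => glue ex (p t) (a t) (b t) 0 i).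
Proof.
move=> rp ra rb Lne i.
have rc k : regular_at t0 (fun t => glue_c (p t) k).
  apply: regularB; first exact: regularC.
  by apply: regularM => //; apply: regularB => //; apply: regularC.
rewrite (_ : (fun _ => _) = fun t => if (i.+1 <= d)%N then glue_a ex (p t) (a t) i.+1
   else if (i.+1 <= 2 * d)%N then glue_b ex (p t) (b t) (i.+1 - d)%N
                else glue_c (p t) (i.+1 - 2 * d)%N); last by apply/funext => t; rewrite mxE.
case: (boolP (i.+1 <= d)%N) => i1; [|case: (boolP (i.+1 <= 2 * d)%N) => i2 //].
  rewrite /glue_a; case: (boolP (ex i.+1)) => // e; apply: regularF => //; exact: Lne.
rewrite /glue_b; case: (boolP (ex (i.+1 - d).-1)) => // e; apply: regularF => //; last by apply: Lne => //; lia.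
by apply: regularB => //; apply: regularC.
Qed.

Definition code_in S x := [exists i, (i \in S) && (i.+1 == x)].
Definition has_a S k := (1 <= k <= d)%N && code_in S k.
Definition has_b S k := (1 <= k <= d)%N && code_in S (d + k)%N.
Definition has_c S k := (1 <= k < d)%N && code_in S (2 * d + k)%N.

Lemma stratumP S u : stratum (pellspace R d) S u <->
  [/\ pellspace R d u, forall k, has_a S k -> u_a u k = 0, forall k, has_b S k -> u_b u k = 0 &
      forall k, has_c S k -> u_c u k = 0].
Proof.
split.
  case=> Uu h; split=> // k /andP [kd /existsP [i /andP [iS /eqP ik]]].
  - by rewrite (u_a_code _ ik) h.
  - by have kd' : (k <= d)%N by [lia]; rewrite (u_b_code _ kd' ik) h.
  - by rewrite (u_c_code _ kd ik) h.
case=> Uu ha hb hc; split=> // i iS.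
have : code_in S i.+1 by apply/existsP; exists i; rewrite iS eqxx.
have [j ij] : exists j : 'I_n, j = i by exists i.
move: (erefl i.+1); rewrite -{2 3}ij; case: (codeP j) => k kd ik ck.
- by rewrite -(u_a_code _ ik) ha // /has_a kd.
- by have kd' : (k <= d)%N by [lia]; rewrite -(u_b_code _ kd' ik) hb // /has_b kd.
- by rewrite -(u_c_code _ kd ik) hc // /has_c kd.
Qed.

Lemma glue_stratum S (ex : nat -> bool) (p a b : nat -> K) :
  p 0%N = 1 -> p d.+1 = 0 -> (forall k, ex k -> (1 <= k < d)%N) ->
  (forall k, ex k -> linked (p k) (p k.+1) (a k) (b k.+1) (glue_c p k)) ->
  (forall k, (k <= d)%N -> ~~ ex k -> glue_c p k != 0) ->
  (forall k, has_a S k -> if ex k then a k = 0 else p k = 0) ->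
  (forall k, has_b S k -> if ex k.-1 then b k = 0 else p k = 1) ->
  (forall k, has_c S k -> glue_c p k = 0) ->
  stratum (pellspace R d) S (glue ex p a b).
Proof.
move=> p0 pd exr L1 L2 ha hb hc; apply/stratumP; split; first exact: glue_links.
- move=> k Sk; rewrite u_a_glue //; last by case/andP: Sk => /andP [].
  by rewrite /glue_a; have := ha k Sk; case: ifP => // _ ->; rewrite mul0r.
- move=> k Sk; rewrite u_b_glue //; last by case/andP: Sk => /andP [-> /leqW].
  by rewrite /glue_b; have := hb k Sk; case: ifP => // _ ->; rewrite subrr mul0r.
- move=> k Sk; rewrite u_c_glue ?hc //; by case/andP: Sk => /andP [_ /ltnW].
Qed.

(** The part of the stratum where c_k vanishes only if S forces it. It is
parametrized by an open subset of an affine space. *)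
Definition in_chart S u := forall k, (k <= d)%N -> ~~ has_c S k -> u_c u k != 0.

Lemma generic_imp (b : bool) (Q : K -> Prop) : (b -> generic Q) -> generic (fun t => b -> Q t).
Proof.
case: b => [|_]; first by move=> /(_ isT); apply: genericW => t.
by exists 1; rewrite ?oner_eq0.
Qed.

(** Let J be the set of the k with c_k(u) = 0 that S does not force. Near u, all links of J
are moved at once by the curve of [linked_near]: c_k = t, p_k = a_k t and
p_(k+1) = (1 - t) / (1 - a_k t). Two links with c_k = 0 are never adjacent, as
p_(k+1) = 1 for the first one, so these prescriptions do not collide. The curve
stays in the stratum, and enters the chart for generic t. *)
Lemma chart_dense S u (f : {mpoly K[n]}) : stratum (pellspace R d) S u -> f.@[u 0] != 0 ->
  exists u', [/\ stratum (pellspace R d) S u', in_chart S u' & f.@[u' 0] != 0].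
Proof.
move=> uS fu; have /stratumP [Uu ha hb hc] := uS.
have /pellspace_links L := Uu.
pose ex k := (1 <= k < d)%N && (u_c u k == 0).
pose J k := ex k && ~~ has_c S k.
have exr k : ex k -> (1 <= k < d)%N by case/andP.
have exL k : ex k -> [/\ u_p u k = 0, u_p u k.+1 = 1 & u_a u k + u_b u k.+1 = 1].
  case/andP => kd /eqP c0; have [|*] := linked_c0 (L k _) c0; first lia.
  by split.
have exS k : ex k -> ex k.+1 = false.
  by move=> /exL [_ e _]; apply/negP => /exL []; rewrite e => /eqP; rewrite oner_eq0.
have exP k : ex k -> ex k.-1 = false.
  move=> ek; have k0 := exr k ek; apply/negP => /exS.
  by have -> : k.-1.+1 = k by [lia]; rewrite ek.
have Lne k : (k <= d)%N -> ~~ ex k -> u_c u k != 0.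
  move=> kd; apply: contraNneq => e; rewrite /ex e eqxx andbT.
  apply/andP; split.
    by case: k kd e => // _ /eqP; rewrite u_c0 oner_eq0.
  rewrite ltn_neqAle kd andbT; apply/eqP => ek.
  by move/eqP: e; rewrite ek u_cd oner_eq0.
have Sex k : has_c S k -> ex k.
  by move=> Sk; rewrite /ex hc // eqxx andbT; case/andP: Sk.
pose p t k : K := if J k then u_a u k * t
  else if J k.-1 then (1 - t) / (1 - u_a u k.-1 * t) else u_p u k.
pose b t k : K := if J k.-1 then (1 - u_a u k.-1) / (1 - u_a u k.-1 * t) else u_b u k.
have Jex k : J k -> ex k by case/andP.
have J1 k : J k.-1 -> k.-1.+1 = k by move=> /Jex /exr; lia.
have p0E : p 0 = u_p u.
  apply/funext => k; rewrite /p; case: ifPn => [/Jex/exL [-> _ _]|_]; first by rewrite mulr0.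
  case: ifPn => // Jk; have /Jex/exL [_ + _] := Jk; rewrite (J1 _ Jk) => ->.
  by rewrite mulr0 !subr0 divr1.
have b0E : b 0 = u_b u.
  apply/funext => k; rewrite /b; case: ifPn => // Jk.
  have /Jex/exL [_ _] := Jk; rewrite (J1 _ Jk) => e.
  by rewrite mulr0 subr0 divr1 -e; ring.
have rlin (c : K) : regular_at 0 (fun t => 1 - c * t).
  apply: regularB; first exact: regularC.
  by apply: regularM; [exact: regularC|exact: regular_id].
have nz1 (c : K) : 1 - c * 0 != 0 by rewrite mulr0 subr0 oner_eq0.
have rp k : regular_at 0 (fun t => p t k).
  rewrite /p; case: (J k); first by apply: regularM; [exact: regularC|exact: regular_id].
  case: (J k.-1); last exact: regularC.
  apply: regularF => //; apply: regularB; [exact: regularC|exact: regular_id].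
have rb k : regular_at 0 (fun t => b t k).
  rewrite /b; case: (J k.-1); last exact: regularC.
  by apply: regularF => //; apply: regularC.
have rc k : regular_at 0 (fun t => glue_c (p t) k).
  apply: regularB; first exact: regularC.
  by apply: regularM => //; apply: regularB => //; apply: regularC.
have cE k : (k <= d)%N -> glue_c (u_p u) k = u_c u k by move=> kd; have [] := L k kd.
have ne0 k : (k <= d)%N -> ~~ ex k -> glue_c (p 0) k != 0.
  by move=> kd ek; rewrite p0E cE // Lne.
pose x t := glue ex (p t) (u_a u) (b t).
have x0 : x 0 = u by rewrite /x p0E b0E glueK.
have rx i : regular_at 0 (fun t => x t 0 i).
  by apply: glue_regular => // k; apply: regularC.
have g1 : generic (fun t : K => t != 0) by exists 'X => [|t]; rewrite ?polyX_eq0 // hornerX.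
have g2 : generic (fun t => forall k, (k < d.+1)%N -> 1 - u_a u k * t != 0).
  apply: generic_all => k kd; exact: (regular_nonzero (rlin _)).
have g3 : generic (fun t => forall k, (k < d.+1)%N -> ~~ ex k -> glue_c (p t) k != 0).
  apply: generic_all => k kd; apply: generic_imp => ek; apply: (regular_nonzero (rc k)).
  exact: ne0.
have g4 : generic (fun t => f.@[x t 0] != 0).
  by apply: (regular_nonzero (regular_meval f rx)); rewrite x0.
have [t [[t0 h2] [h3 h4]]] := generic_ex (genericI (genericI g1 g2) (genericI g3 g4)).
have pd : p t d.+1 = 0.
  rewrite /p ifF; last by apply/negP => /Jex/exr; lia.
  by rewrite ifF ?u_pS //=; apply/negP => /Jex/exr; lia.
have p0 : p t 0%N = 1 by exact: u_p0.
have LJ k : J k -> linked (p t k) (p t k.+1) (u_a u k) (b t k.+1) t.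
  move=> Jk; rewrite /p /b /= Jk.
  have -> : J k.+1 = false by rewrite /J exS //; apply: Jex.
  by apply: linked_near; apply: h2; have := exr _ (Jex _ Jk); lia.
have gcJ k : J k -> glue_c (p t) k = t by move=> /LJ [].
have pP k : ~~ J k -> ~~ J k.-1 -> p t k = u_p u k by rewrite /p => /negbTE -> /negbTE ->.
have pS k : ex k -> ~~ J k -> [/\ p t k = u_p u k, p t k.+1 = u_p u k.+1 & glue_c (p t) k = u_c u k].
  move=> ek Jk; have e1 : p t k = u_p u k by apply: pP => //; rewrite /J exP.
  have e2 : p t k.+1 = u_p u k.+1 by apply: pP => //; rewrite /J exS.
  by split=> //; rewrite -cE; [rewrite /glue_c e1 e2|have := exr k ek; lia].
exists (x t); split=> //; last first.
  move=> k kd Sk; rewrite u_c_glue //.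
  have [ek|] := boolP (ex k); last exact: h3.
  by rewrite gcJ // /J ek.
apply: glue_stratum => //.
- move=> k ek; have [Jk|Jk] := boolP (J k); first by rewrite gcJ //; apply: LJ.
  have [-> -> ->] := pS k ek Jk; rewrite /b /= (negbTE Jk).
  by apply: L; have := exr k ek; lia.
- move=> k Sk; case: ifPn => ek; first exact: ha.
  have Pk : u_p u k = 0 by rewrite /u_p ha // mul0r if_same.
  rewrite pP //; first by rewrite /J (negbTE ek).
  apply/negP => Jk; have /Jex/exL [_ + _] := Jk; rewrite (J1 _ Jk) Pk => /eqP.
  by rewrite eq_sym oner_eq0.
- move=> k Sk; have kd : (1 <= k <= d)%N by case/andP: Sk.
  have kk : k.-1.+1 = k by lia.
  have Bk := hb k Sk.
  case: ifPn => ek.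
    rewrite /b; case: ifPn => // _; have [_ _ e] := exL _ ek.
    by rewrite kk Bk addr0 in e; rewrite e subrr mul0r.
  have Pk : u_p u k = 1.
    have [|_ _ + _ _] := L k.-1; first lia.
    by rewrite kk Bk mul0r => /esym/eqP; rewrite subr_eq0 => /eqP.
  rewrite pP //; last by rewrite /J (negbTE ek).
  by apply/negP => /Jex/exL [e _ _]; move/eqP: Pk; rewrite e eq_sym oner_eq0.
- move=> k Sk; have ek := Sex k Sk.
  have Jk : ~~ J k by rewrite /J Sk andbF.
  by have [_ _ ->] := pS k ek Jk; apply: hc.
Qed.

(** By [chart_dense] both points can be taken in the chart. There the segment
between their coordinates, namely all p_k and the a_k and b_(k+1) of the links with
c_k in S, defines a rational curve in the stratum through both points. *)
Lemma stratum_irreducible S : (stratum (pellspace R d) S !=set0)%classic ->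
  irreducible (stratum (pellspace R d) S).
Proof.
move=> S0; apply: irreducible_by_points => // u0 v0 f g u0S v0S fu0 gv0.
have [u [/stratumP [Uu uA uB uC] uch fu]] := chart_dense u0S fu0.
have [v [/stratumP [Uv vA vB vC] vch gv]] := chart_dense v0S gv0.
have Lu := (pellspace_links u).1 Uu; have Lv := (pellspace_links v).1 Uv.
pose ex := has_c S.
have exr k : ex k -> (1 <= k < d)%N by case/andP.
pose seg (y z : nat -> K) (t : K) k := y k + t * (z k - y k).
have seg0 y z : seg y z 0 = y by apply/funext => k; rewrite /seg mul0r addr0.
have seg1 y z : seg y z 1 = z by apply/funext => k; rewrite /seg mul1r; ring.
have segc y z t k (c : K) : y k = c -> z k = c -> seg y z t k = c.
  by rewrite /seg => -> ->; rewrite subrr mulr0 addr0.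
have rseg t0 y z k : regular_at t0 (fun t => seg y z t k).
  apply: regularD; first exact: regularC.
  by apply: regularM; [exact: regular_id|exact: regularC].
pose p := seg (u_p u) (u_p v).
have rc t0 k : regular_at t0 (fun t => glue_c (p t) k).
  apply: regularB; first exact: regularC.
  by apply: regularM; [apply: regularB; [exact: regularC|exact: rseg]|exact: rseg].
pose x t := glue ex (p t) (seg (u_a u) (u_a v) t) (seg (u_b u) (u_b v) t).
have x0 : x 0 = u by rewrite /x /p !seg0 glueK.
have x1 : x 1 = v by rewrite /x /p !seg1 glueK.
have cu k : (k <= d)%N -> ~~ ex k -> glue_c (p 0) k != 0.
  by move=> kd ek; rewrite /p seg0; have [e _ _ _ _] := Lu k kd; rewrite /glue_c -e; apply: uch.
have cv k : (k <= d)%N -> ~~ ex k -> glue_c (p 1) k != 0.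
  by move=> kd ek; rewrite /p seg1; have [e _ _ _ _] := Lv k kd; rewrite /glue_c -e; apply: vch.
have g1 : generic (fun t => forall k, (k < d.+1)%N -> ~~ ex k -> glue_c (p t) k != 0).
  apply: generic_all => k kd; apply: generic_imp => ek; apply: (regular_nonzero (rc 0 k)).
  exact: cu.
have g2 : generic (fun t => f.@[x t 0] != 0).
  apply: (regular_nonzero (t0 := 0)); last by rewrite x0.
  by apply: regular_meval => i; apply: glue_regular => // k; apply: rseg.
have g3 : generic (fun t => g.@[x t 0] != 0).
  apply: (regular_nonzero (t0 := 1)); last by rewrite x1.
  by apply: regular_meval => i; apply: glue_regular => // k; apply: rseg.
have [t [h1 [h2 h3]]] := generic_ex (genericI g1 (genericI g2 g3)).
exists (x t) => //.
have cE k : ex k -> [/\ p t k = 0, p t k.+1 = 1 &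
    seg (u_a u) (u_a v) t k + seg (u_b u) (u_b v) t k.+1 = 1].
  move=> ek; have kd : (k <= d)%N by have := exr k ek; lia.
  have [u1 u2 u3] := linked_c0 (Lu k kd) (uC k ek).
  have [v1 v2 v3] := linked_c0 (Lv k kd) (vC k ek).
  split; [exact: segc|exact: segc|].
  rewrite /seg -[RHS](_ : (u_a u k + u_b u k.+1) + t * ((u_a v k + u_b v k.+1) - (u_a u k + u_b u k.+1)) = 1).
    by ring.
  by rewrite u3 v3 subrr mulr0 addr0.
have gc0 k : ex k -> glue_c (p t) k = 0.
  by move=> /cE [e1 e2 _]; rewrite /glue_c e1 e2; ring.
apply: glue_stratum => //.
- by apply: segc; rewrite u_p0.
- by apply: segc; rewrite u_pS.
- by move=> k ek; rewrite gc0 //; have [-> -> e] := cE k ek; apply: linked0.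
- move=> k Sk; case: ifPn => ek; first by apply: segc; [apply: uA|apply: vA].
  by apply: segc; rewrite /u_p ?uA ?vA // mul0r if_same.
- move=> k Sk; case: ifPn => ek; first by apply: segc; [apply: uB|apply: vB].
  have kd : (1 <= k <= d)%N by case/andP: Sk.
  have kk : k.-1.+1 = k by lia.
  apply: segc; apply/eqP; rewrite eq_sym -subr_eq0; apply/eqP.
    by have [|_ _ + _ _] := Lu k.-1; [lia|rewrite kk uB // mul0r => <-].
  by have [|_ _ + _ _] := Lv k.-1; [lia|rewrite kk vB // mul0r => <-].
Qed.

(** All p_k are chosen in {0, 1, 2}: 0 or 1 where S or the link requires it, and the neutral
value 2 elsewhere. With these values c_k = 1 - (1 - p_k) p_(k+1) vanishes only for p_k = 0 and
p_(k+1) = 1; if c_k is not in S, this would mean that the incompatible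
variables a_k and b_(k+1) are both in S. *)
Lemma stratum_point S : clique S ->
  exists2 u, stratum (pellspace R d) S u & forall i, i \notin S -> u 0 i != 0.
Proof.
move=> cS.
have cc x y : code_in S x -> code_in S y -> incomp d x y -> False.
  move=> /existsP [i /andP [iS /eqP <-]] /existsP [j /andP [jS /eqP <-]].
  by apply/negP; apply: cS.
have ab k : has_a S k -> has_b S k -> False.
  by case/andP => kd h1 /andP [_ h2]; apply: (cc _ _ h1 h2); rewrite incomp_aE // eqxx.
have ab1 k : has_a S k -> has_b S k.+1 -> False.
  by case/andP => kd h1 /andP [kd' h2]; apply: (cc _ _ h1 h2); rewrite incomp_aE //; lia.
have ac k : has_a S k.+1 -> has_c S k -> False.
  by case/andP => kd h1 /andP [kd' h2]; apply: (cc _ _ h1 h2); rewrite incomp_aE //; lia.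
have bc k : has_b S k -> has_c S k -> False.
  by case/andP => kd h1 /andP [kd' h2]; apply: (cc _ _ h1 h2); rewrite incomp_bE //; lia.
have c2 k : has_c S k -> has_c S k.+1 -> False.
  by case/andP => kd h1 /andP [kd' h2]; apply: (cc _ _ h1 h2); rewrite incomp_cE //; lia.
pose ex := has_c S.
have exr k : ex k -> (1 <= k < d)%N by case/andP.
have n2 : (2 : K) != 0 by rewrite pnatr_eq0.
have n12 : (2 : K) != 1 by rewrite (eqr_nat K 2 1).
pose p k : K := if k == 0%N then 1 else if k == d.+1 then 0 else
    if has_a S k then 0 else if has_b S k then 1 else
  if has_c S k then 0 else if has_c S k.-1 then 1 else 2.
pose a k : K := if has_a S k then 0 else if has_b S k.+1 then 1 else 2.
pose b k : K := 1 - a k.-1.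
have p0 : p 0%N = 1 by [].
have pd : p d.+1 = 0 by rewrite /p eqxx.
have pC k : has_c S k -> p k = 0 /\ p k.+1 = 1.
  move=> Sk; have kd := exr k Sk; rewrite /p.
  have -> : (k == 0)%N = false by lia. have -> : (k == d.+1)%N = false by lia.
  have -> : (k.+1 == d.+1)%N = false by lia.
  case: ifP => [_|_].
    case: ifP => [/ac/(_ Sk) //|_]; case: ifP => // _.
    by case: ifP => [/(c2 _ Sk) //|_]; rewrite Sk.
  case: ifP => [/bc/(_ Sk) //|_]; rewrite Sk /=.
  case: ifP => [/ac/(_ Sk) //|_]; case: ifP => // _.
  by case: ifP => [/(c2 _ Sk) //|_].
have p0' k : (k <= d)%N -> p k = 0 -> has_a S k \/ has_c S k.
  move=> kd; rewrite /p; case: ifP => _; first by move/eqP; rewrite oner_eq0.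
  have -> : (k == d.+1) = false by lia.
  case: ifP => [Ska|_]; first by left.
  case: ifP => [_ /eqP|_]; first by rewrite oner_eq0.
  case: ifP => [Ska|_]; first by right.
  by case: ifP => _ /eqP; rewrite ?oner_eq0 ?(negbTE n2).
have p1' k : (1 <= k <= d)%N -> p k = 1 -> has_b S k \/ has_c S k.-1.
  move=> kd; rewrite /p.
  have -> : (k == 0)%N = false by lia. have -> : (k == d.+1) = false by lia.
  case: ifP => [_ /eqP|_]; first by rewrite eq_sym oner_eq0.
  case: ifP => [|_]; first by left.
  case: ifP => [_ /eqP|_]; first by rewrite eq_sym oner_eq0.
  by case: ifP => [|_ /eqP]; [right|rewrite (negbTE n12)].
have p3 k : [\/ p k = 0, p k = 1 | p k = 2].
  rewrite /p; do ![case: ifP => _]; by [constructor 1|constructor 2|constructor 3].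
have gne k : (k <= d)%N -> ~~ ex k -> glue_c p k != 0.
  move=> kd ek; apply/eqP => g0.
  have [pk pk1] : p k = 0 /\ p k.+1 = 1.
    move: g0; rewrite /glue_c; case: (p3 k) => ->; case: (p3 k.+1) => -> /eqP;
      rewrite ?subrr ?mul0r ?mulr0 ?subr0 ?mul1r ?mulr1 ?oner_eq0 //.
    + by rewrite (_ : 1 - 2 = -1 :> K) ?oppr_eq0 ?oner_eq0 //; ring.
    + by rewrite (_ : 1 - (1 - 2) = 2 :> K) ?(negbTE n2) //; ring.
    + by rewrite (_ : 1 - (1 - 2) * 2 = 3 :> K) ?pnatr_eq0 //; ring.
  have kd' : (1 <= k.+1 <= d)%N.
    by rewrite ltnS leq0n /= ltn_neqAle kd andbT; apply/eqP => e; move/eqP: pk1; rewrite e pd eq_sym oner_eq0.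
  case: (p0' k kd pk) => [Sk|]; last by apply/negP.
  case: (p1' _ kd' pk1) => [Sk1|]; last by apply/negP.
  exact: ab1 Sk Sk1.
have gC k : ex k -> glue_c p k = 0 by move=> /pC [e1 e2]; rewrite /glue_c e1 e2; ring.
exists (glue ex p a b).
  apply: glue_stratum => //.
  - move=> k ek; rewrite gC //; have [-> ->] := pC k ek; apply: linked0.
    by rewrite /b /=; ring.
  - move=> k Sk; case: ifP => _; first by rewrite /a Sk.
    have kd : (1 <= k <= d)%N by case/andP: Sk.
    rewrite /p Sk; have -> : (k == 0)%N = false by lia.
    by case: ifP.
  - move=> k Sk; have kd : (1 <= k <= d)%N by case/andP: Sk.
    have kk : k.-1.+1 = k by lia.
    case: ifP => ek.
      rewrite /b /a kk Sk; case: ifP => [Sk'|_]; last by rewrite subrr.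
      by case: (ab1 _ Sk'); rewrite kk.
    rewrite /p Sk; have -> : (k == 0)%N = false by lia.
    have -> : (k == d.+1)%N = false by lia.
    by case: ifP => // /ab/(_ Sk).
move=> i; have [j ij] : exists j : 'I_n, j = i by exists i.
have icode x : i.+1 = x -> i \notin S -> ~~ code_in S x.
  move=> <-; apply: contra => /existsP [l /andP [lS /eqP [/val_inj <-]]]; exact: lS.
move: (erefl i.+1); rewrite -{2}ij; case: (codeP j) => k kd ik /(icode _ ik) iS.
- rewrite -(u_a_code _ ik) u_a_glue //; last by case/andP: kd.
  have Ska : has_a S k = false by rewrite /has_a (negbTE iS) andbF.
  rewrite /glue_a; case: ifPn => ek.
    by rewrite /a Ska; case: ifP => _; rewrite ?oner_eq0.
  rewrite mulf_neq0 ?invr_eq0 ?gne //; last by case/andP: kd.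
  apply/eqP => /p0'; case; [by case/andP: kd|by rewrite Ska|exact/negP].
- have kd' : (k <= d)%N by lia.
  have kk : k.-1.+1 = k by lia.
  rewrite -(u_b_code _ kd' ik) u_b_glue //; last by lia.
  have Skb : has_b S k = false by rewrite /has_b (negbTE iS) andbF.
  rewrite /glue_b; case: ifPn => ek.
    rewrite /b /a kk Skb; case: ifP => _; rewrite ?subr0 ?oner_eq0 //.
    by rewrite (_ : 1 - 2 = -1 :> K) ?oppr_eq0 ?oner_eq0 //; ring.
  rewrite mulf_neq0 ?invr_eq0 ?gne //; last by lia.
  rewrite subr_eq0 eq_sym; apply/eqP => /(p1' _ kd) [|]; [by rewrite Skb|exact/negP].
- rewrite -(u_c_code _ kd ik) u_c_glue //; last by lia.
  by apply: gne; [lia|rewrite /ex /has_c (negbTE iS) andbF].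
Qed.

End Space.

(** * Dimension and codimension of the strata *)

Section Final.
Variables (R : realType) (d : nat).
Hypothesis hd : (1 <= d)%N.
Local Notation K := R[i].
Local Notation n := (3 * d - 1)%N.
Local Notation U := (pellspace R d).
Implicit Types (u v : 'rV[K]_n) (k : nat) (S T : {set 'I_n}).

(** The p_k and c_k as polynomials in the coordinates p_1, ..., p_d of the chart where no c_k
vanishes. *)
Definition coord_poly k : {mpoly K[d]} :=
  if k == 0%N then 1 else if (k <= d)%N then mvar K d k else 0.
Definition c_poly k := 1 - (1 - coord_poly k) * coord_poly k.+1.
Definition chart_coord u (i : 'I_d) : K := u_p u i.+1.

Lemma coord_polyE u k : (k <= d.+1)%N -> (coord_poly k).@[chart_coord u] = u_p u k.
Proof.
rewrite /coord_poly; case: eqP => [->|k0] kd; first by rewrite meval1 u_p0.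
case: ifP => kd'; last by rewrite meval0 /u_p kd'.
have kd2 : (k.-1 < d)%N by lia.
by rewrite /mvar insubT mevalXU /chart_coord /=; congr (u_p u _); lia.
Qed.

Lemma c_polyE u k : U u -> (k <= d)%N -> (c_poly k).@[chart_coord u] = u_c u k.
Proof.
move=> /(pellspace_links hd) L kd; have [-> _ _ _ _] := L k kd.
by rewrite mevalB mevalM mevalB !meval1 !coord_polyE //; apply: leqW.
Qed.

Definition chart_den := \prod_(k < d.+1) c_poly k.

(** The functions on that chart that are rational in p_1, ..., p_d with a power of
the product of the c_k as denominator. *)
Definition chart_regular (h : 'rV[K]_n -> K) := exists (F : {mpoly K[d]}) (e : nat),
  forall u, U u -> (forall k, (k <= d)%N -> u_c u k != 0) ->
    h u * chart_den.@[chart_coord u] ^+ e = F.@[chart_coord u].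

Lemma chart_regularD h g : chart_regular h -> chart_regular g -> chart_regular (fun u => h u + g u).
Proof.
move=> [F [e FE]] [G [e' GE]]; exists (F * chart_den ^+ e' + G * chart_den ^+ e), (e + e')%N.
by move=> u Uu cu; rewrite mevalD !mevalM !rmorphXn /= -FE // -GE // exprD; ring.
Qed.

Lemma chart_regularM h g : chart_regular h -> chart_regular g -> chart_regular (fun u => h u * g u).
Proof.
move=> [F [e FE]] [G [e' GE]]; exists (F * G), (e + e')%N.
by move=> u Uu cu; rewrite mevalM -FE // -GE // exprD; ring.
Qed.

Lemma chart_regular_poly (h : 'rV[K]_n -> K) F :
  (forall u, U u -> h u = F.@[chart_coord u]) -> chart_regular h.
Proof. by move=> hF; exists F, 0%N => u Uu _; rewrite expr0 mulr1 hF. Qed.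

Lemma chart_regularV k : (k <= d)%N -> chart_regular (fun u => (u_c u k)^-1).
Proof.
move=> kd; have kd' : (k < d.+1)%N by [].
exists (\prod_(j < d.+1 | j != Ordinal kd') c_poly j), 1%N => u Uu cu.
rewrite expr1 /chart_den (bigD1 (Ordinal kd')) //= mevalM c_polyE // mulrA mulVf ?mul1r //.
exact: cu.
Qed.

Lemma chart_regular_eq h g :
  (forall u, U u -> (forall k, (k <= d)%N -> u_c u k != 0) -> h u = g u) ->
  chart_regular g -> chart_regular h.
Proof. by move=> hk [F [e FE]]; exists F, e => u Uu cu; rewrite hk // FE. Qed.

Lemma chart_regular_coord (i : 'I_n) : chart_regular (fun u => u 0 i).
Proof.
have rP k : (k <= d.+1)%N -> chart_regular (fun u => u_p u k).
  by move=> kd; apply: (@chart_regular_poly _ (coord_poly k)) => u Uu; rewrite coord_polyE.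
have [j ij] : exists j : 'I_n, j = i by exists i.
move: (erefl i.+1); rewrite -{2}ij; case: (codeP j) => k kd ik.
- apply: (@chart_regular_eq _ (fun u => u_p u k * (u_c u k)^-1)).
    move=> u Uu cu; rewrite -(u_a_code _ ik).
    have [|_ <- _ _ _] := (pellspace_links hd u).1 Uu k; first lia.
    by rewrite mulfK // cu //; lia.
  by apply: chart_regularM; [apply: rP|apply: chart_regularV]; lia.
- have kk : k.-1.+1 = k by lia.
  have kd' : (k <= d)%N by lia.
  apply: (@chart_regular_eq _ (fun u => (1 - u_p u k) * (u_c u k.-1)^-1)).
    move=> u Uu cu; rewrite -(u_b_code hd _ kd' ik).
    have [|_ _ + _ _] := (pellspace_links hd u).1 Uu k.-1; first lia.
    by rewrite kk => <-; rewrite mulfK // cu //; lia.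
  apply: chart_regularM; last by apply: chart_regularV; lia.
  apply: (@chart_regular_poly _ (1 - coord_poly k)) => u Uu.
  by rewrite mevalB meval1 coord_polyE //; lia.
- apply: (@chart_regular_poly _ (c_poly k)) => u Uu.
  by rewrite c_polyE -?(u_c_code hd _ kd ik) //; lia.
Qed.

Lemma chart_regular_meval (f : {mpoly K[n]}) : chart_regular (fun u => f.@[u 0]).
Proof.
apply: (meval_closed (x := fun (u : 'rV[K]_n) i => u 0 i)).
- by move=> c; apply: (@chart_regular_poly _ c%:MP) => u _; rewrite mevalC.
- exact: chart_regular_coord.
- exact: chart_regularD.
- exact: chart_regularM.
Qed.

Lemma has_c_set0 k : has_c (finset.set0 : {set 'I_n}) k = false.
Proof. by rewrite /has_c; apply/negP => /andP [_ /existsP [j]]; rewrite inE. Qed.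

Lemma stratum0 : stratum U finset.set0 = U.
Proof. by apply/seteqP; split => u; [case|split=> // i; rewrite inE]. Qed.

(** On the dense chart, m > d polynomials become rational functions of d variables with
a common denominator. The resulting dependence is a closed condition, so it holds
on the whole variety. *)
Lemma pellspace_indep m : has_indep U m -> (m <= d)%N.
Proof.
case=> f fi; rewrite leqNgt; apply/negP => dm.
have /choice [Fe FeP] : forall j : 'I_m, exists Fe : {mpoly K[d]} * nat,
    forall u, U u -> (forall k, (k <= d)%N -> u_c u k != 0) ->
    (f j).@[u 0] * chart_den.@[chart_coord u] ^+ Fe.2 = Fe.1.@[chart_coord u].
  by move=> j; have [F [e FE]] := chart_regular_meval (f j); exists (F, e).
pose E := (\sum_j (Fe j).2)%N.
have eE j : ((Fe j).2 <= E)%N by rewrite /E (bigD1 j) //= leq_addr.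
(* The exponent E serves for the denominators of all f_j. *)
have [Q Q0 QE] := algebraic_dependence
  (fun j => (Fe j).1 * chart_den ^+ (E - (Fe j).2)) (chart_den ^+ E) dm.
case/eqP: Q0; apply: fi => u Uu; apply/eqP/negP => /negP.
pose g := Q \mPo [tuple f j | j < m].
have gE v : g.@[v 0] = Q.@[fun j => (f j).@[v 0]].
  by rewrite comp_mpoly_meval; apply: meval_eq => j; rewrite tnth_mktuple.
rewrite -gE => gu.
have [||v [vS vch]] := @chart_dense _ _ hd finset.set0 u g; [by rewrite stratum0|by []|].
rewrite stratum0 in vS.
have {}vch k : (k <= d)%N -> u_c v k != 0 by move=> kd; apply: vch => //; rewrite has_c_set0.
case/negP; rewrite gE; apply/eqP.
have D0 : chart_den.@[chart_coord v] != 0.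
  rewrite /chart_den rmorph_prod /= prodf_seq_neq0; apply/allP => k _ /=.
  by rewrite c_polyE ?vch // -ltnS.
rewrite -[RHS](QE (chart_coord v)); last by rewrite rmorphXn expf_neq0.
apply: meval_eq => j; rewrite mevalM !rmorphXn /= -FeP //.
apply: (mulIf (expf_neq0 E D0)); rewrite mulfVK ?expf_neq0 //.
by rewrite -mulrA -exprD subnKC.
Qed.

Lemma stratum_closed S : zariski_closed (stratum U S).
Proof.
exists [set q | (exists i, @pell_equation R d i = q) \/ exists2 i, i \in S & q = 'X_i]%classic.
apply/seteqP; split=> u /=.
  by case=> Uu h q [[i <-]|[i iS ->]]; [apply: Uu; exists i|rewrite mevalXU h].
move=> h; split=> [q [i _ <-]|i iS]; first by apply: h; left; exists i.
by have := h 'X_i; rewrite mevalXU; apply; right; exists i.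
Qed.

(** If two incompatible coordinates vanish at a point, the u-equation of one of them
reads 0 + 0 - 1 = 0. *)
Lemma stratum_nonempty S : (stratum U S !=set0)%classic <-> clique S.
Proof.
split=> [[u [Uu uS]] i j iS jS|/(stratum_point R hd) [u uS _]]; last by exists u.
apply/negP => ij; have [a [a0 aE]] := pell_u_equation R i.
have : (@pell_equation R d i).@[u 0] = 0 by apply: Uu; exists i.
rewrite aE mevalB mevalD meval1 mevalXU uS // (bigD1 j) /=; last by rewrite incompatibleE.
rewrite mevalM rmorphXn /= mevalXU uS // expr0n gtn_eqF; last by apply: a0; rewrite incompatibleE.
by rewrite mul0r addr0 sub0r => /eqP; rewrite oppr_eq0 oner_eq0.
Qed.

Lemma stratum_irr S : clique S -> irreducible (stratum U S).
Proof. by move=> /stratum_nonempty; apply: stratum_irreducible. Qed.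

Lemma stratum_proper S T :
  clique S -> S \subset T -> S != T -> (stratum U T `<` stratum U S)%classic.
Proof.
move=> cS /[dup] ST /fintype.subsetP ST' nST; split=> [u [Uu uT]|].
  by split=> // i /ST'; apply: uT.
move=> TS; have [u uS u0] := stratum_point R hd cS.
have /fintype.subsetPn [i iT iS] : ~~ (T \subset S).
  by apply: contra nST => TS'; rewrite finset.eqEsubset ST.
by have [_ /(_ i iT) /eqP] := TS u uS; rewrite (negbTE (u0 i iS)).
Qed.

(** The rank grows by at least one whenever a variable is dropped, and the stratum of T
is nonempty. *)
Lemma stratum_has_indep T S : clique T -> S \subset T -> has_indep (stratum U S) (#|T| - #|S|).
Proof.
move=> cT; move: {2}(#|T| - #|S|)%N (erefl (#|T| - #|S|)%N) => m.
elim: m S => [|m IH] S Sm ST.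
  by rewrite Sm; apply: has_indep0; apply/stratum_nonempty; apply: clique_sub ST cT.
rewrite Sm.
have /fintype.subsetPn [i iT iS] : ~~ (T \subset S).
  by apply/negP => /subset_leq_card; lia.
have ST' : (i |: S)%SET \subset T by rewrite finset.subUset finset.sub1set iT.
have c1 : #|(i |: S)%SET| = #|S|.+1 by rewrite cardsU1 iS.
have e1 : (#|T| - #|(i |: S)%SET|)%N = m by lia.
have cS := clique_sub ST cT.
apply: (has_indepS (Z := stratum U (i |: S)%SET)); last by rewrite -e1; apply: IH.
- exact: stratum_closed.
- exact: stratum_irr.
- apply: stratum_proper => //; first exact: finset.subsetUr.
  by apply: contraNneq iS => ->; rewrite !inE eqxx.
Qed.

(** The variables of S are dropped one by one. *)
Lemma stratum_chain S : clique S ->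
  exists Z, [/\ irreducible_chain #|S| Z, Z 0%N = stratum U S & (Z #|S| `<=` U)%classic].
Proof.
move=> cS; pose D k : {set 'I_n} := [set x in drop k (enum S)]%SET.
have DS k : D k \subset S.
  by apply/fintype.subsetP => x; rewrite inE => /mem_drop; rewrite mem_enum.
have cD k : clique (D k) := clique_sub (DS k) cS.
have D0 : D 0%N = S by apply/setP => x; rewrite inE drop0 mem_enum.
exists (fun k => stratum U (D k)); split; last by move=> u [].
  split=> [k kS|k kS]; first by split; [apply: stratum_closed|apply: stratum_irr].
  have ks : (k < size (enum S))%N by rewrite -cardE.
  have x0 : 'I_n by case: (enum S) ks.
  have Dk := drop_nth x0 ks.
  apply: stratum_proper => //.
    by apply/fintype.subsetP => x; rewrite !inE Dk inE orbC => ->.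
  apply/eqP => /setP /(_ (nth x0 (enum S) k)); rewrite !inE Dk mem_head.
  have := drop_uniq k (enum_uniq S); rewrite Dk /= => /andP [/negbTE -> _].
  by [].
by rewrite D0.
Qed.

Lemma clique0 : clique (finset.set0 : {set 'I_n}).
Proof. by move=> i j; rewrite inE. Qed.

Theorem pellspace_binary : is_binary_geometry (pell_complex R d) U.
Proof.
split.
- exists (@pell_equation R d) => //; exact: pell_u_equation.
- split.
    have [|S /pell_complexE cS ->] := @eq_bigmax_cond _ (mem (pell_complex R d)) (fun S : {set 'I_n} => #|S|).
      by rewrite card_gt0; apply/set0Pn; exists finset.set0; apply/pell_complexE/clique0.
    by have [Z [cZ _ ZU]] := stratum_chain cS; exists Z.
  move=> l Z cZ ZU.
  have Z0 : (Z 0%N !=set0)%classic by have [] := cZ.1 0%N isT; move=> _ [].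
  have lU : has_indep U l := has_indep_sub ZU (chain_indep cZ (has_indep0 Z0)).
  have [T [_ cT dT]] := clique_facet R clique0.
  apply: leq_trans (pellspace_indep lU) (leq_trans dT _).
  by apply: (@leq_bigmax_cond _ (mem (pell_complex R d)) (fun S : {set 'I_n} => #|S|)); apply/pell_complexE.
- by move=> S; rewrite stratum_nonempty pell_complexE.
- move=> S /stratum_nonempty cS; split; first exact: stratum_irr.
  split; first exact: stratum_chain.
  move=> l Z cZ Z0 ZU.
  have [T [ST cT dT]] := clique_facet R cS.
  have hS := stratum_has_indep cT ST; rewrite -Z0 in hS.
  have := pellspace_indep (has_indep_sub ZU (chain_indep cZ hS)).
  by have := subset_leq_card ST; lia.
Qed.
End Final.

Theorem theorem1p1 (R : realType) (d : nat) (hd : (1 <= d)%N) :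
  [/\ is_flag_complex (pell_complex R d),
      forall i : 'I_(3 * d - 1),
        is_u_equation (pell_complex R d) i (@pell_equation R d i)
    & is_binary_geometry (pell_complex R d) (pellspace R d)].
Proof.
split; [exact: pell_flag|exact: pell_u_equation|exact: pellspace_binary].
Qed.
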